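(* For every positive integer $n$, there exists an $\mathrm{mcDSQS}(2\cdot 9^{n}+2)$.
   Context: A Steiner triple system $\mathrm{STS}(v)$ is a pair $(X,\mathcal{B})$ with $|X|=v$ and $\mathcal{B}$ a set of $3$-subsets (blocks) such that every $2$-subset of $X$ lies in exactly one block. A Steiner quadruple system $\mathrm{SQS}(v)$ is $(X,\mathcal{B})$ with $\mathcal{B}$ a set of $4$-subsets such that every $3$-subset lies in exactly one block; for $x\in X$ its derived design at $x$ is the $\mathrm{STS}(v-1)$ $(X\setminus\{x\},\{B\setminus\{x\}:x\in B\in\mathcal{B}\})$. A partial parallel class (PPC) of a set $Y$ is a collection of pairwise disjoint blocks contained in $Y$. An $r$-coloring of a design is a partition of its block set into $r$ PPCs of its point set. The chromatic index $\chi'(v)$ is the minimum, over all $\mathrm{STS}(v)$, of the least $r$ such that the $\mathrm{STS}(v)$ admits an $r$-coloring. An $\mathrm{STS}(v)$ admitting a $\chi'(v)$-coloring is called minimum colorable ($\mathrm{mcSTS}(v)$). An $\mathrm{mcDSQS}(v)$ is an $\mathrm{SQS}(v)$ whose derived design at every point is an $\mathrm{mcSTS}(v-1)$. *)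

(* Defs.v *)
From mathcomp Require Import all_boot.
Set Implicit Arguments. Unset Strict Implicit. Unset Printing Implicit Defensive.

Definition is_STS (X : finType) (Y : {set X}) (Bs : {set {set X}}) : Prop :=
  (forall B, B \in Bs -> B \subset Y /\ #|B| = 3) /\
  (forall P : {set X}, P \subset Y -> #|P| = 2 ->
     #|[set B in Bs | P \subset B]| = 1).

Definition is_SQS (X : finType) (Bs : {set {set X}}) : Prop :=
  (forall B, B \in Bs -> #|B| = 4) /\
  (forall T : {set X}, #|T| = 3 -> #|[set B in Bs | T \subset B]| = 1).

Definition derived (X : finType) (Bs : {set {set X}}) (x : X) : {set {set X}} :=
  [set B :\ x | B in [set B in Bs | x \in B]].

(* An r-coloring of the block set: a partition of Bs into r partial
   parallel classes, encoded by a color function whose color classes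
   consist of pairwise disjoint blocks (blocks already lie in the point set). *)
Definition r_colorable (X : finType) (Bs : {set {set X}}) (r : nat) : Prop :=
  exists c : {set X} -> 'I_r,
    forall B1 B2, B1 \in Bs -> B2 \in Bs -> B1 != B2 -> c B1 = c B2 ->
      [disjoint B1 & B2].

(* r is the chromatic index chi'(v): some STS(v) is r-colorable, and no
   STS(v) is s-colorable with s < r.  (STS(v) taken on the point set 'I_v;
   all notions are invariant under relabelling of points.) *)
Definition is_chromatic_index (v r : nat) : Prop :=
  (exists Bs : {set {set 'I_v}}, is_STS [set: 'I_v] Bs /\ r_colorable Bs r) /\
  (forall (Bs : {set {set 'I_v}}) (s : nat),
     is_STS [set: 'I_v] Bs -> r_colorable Bs s -> r <= s).

Definition is_mcSTS (X : finType) (Y : {set X}) (Bs : {set {set X}}) : Prop :=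
  is_STS Y Bs /\ exists r, is_chromatic_index #|Y| r /\ r_colorable Bs r.

Definition is_mcDSQS (X : finType) (Bs : {set {set X}}) : Prop :=
  is_SQS Bs /\ forall x : X, is_mcSTS [set~ x] (derived Bs x).

(* Main.v *)
Require Import Defs.
From mathcomp Require Import all_boot all_order all_algebra all_fingroup all_field.
From mathcomp Require Import ring.
Set Implicit Arguments. Unset Strict Implicit. Unset Printing Implicit Defensive.
Import GRing.Theory.

(** Put q = 9^n. The images of the projective line over GF(9) form a Steiner
    system S(3,10,q+1) of circles on P = PG(1,q), whose derived design at x is
    the affine space AG(n,9), with the circles through x as lines. Replace
    every point by a fiber of two points and place on each circle an SQS(20) in
    which the union of any two fibers is a block. Circles meet in at most two
    points, so these systems agree wherever they overlap and together form an
    SQS(2q+2), however the individual circles are labelled.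

    Fix x in P and a second point o. For a line l through o, take a coloring of
    the derived STS(19) on l by ten classes: one for each b in l, containing
    the block of the fiber of b, and a class D avoiding the fiber of o. For a
    line l not through o, resolve the remaining blocks of the derived design
    into 8 parallel classes and use them to complete, for the line l' through o
    parallel to l, the classes of the 8 points of l' other than o. The classes
    of o on all lines through o merge into one class, and so do the classes D:
    this gives q + 1 colors, named by the points of P (with D named by x).

    Conversely each point of an STS(2q+1) lies in q blocks, so q colors would
    partition 2q+1 points into triples, although 3 does not divide 2q+1. *)

(** * Blocks under injections *)

Lemma set3P (T : finType) (A : {set T}) : #|A| = 3 ->
  exists a b c, [/\ A = [set a; b; c], a != b, a != c & b != c].
Proof.
move=> A3; have /card_gt0P[a aA] : 0 < #|A| by rewrite A3.
have /eqP/cards2P[b [c [bc E]]] : #|A :\ a| = 2 by move: A3; rewrite (cardsD1 a) aA => -[].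
have aE : a \notin [set b; c] by rewrite -E !inE eqxx.
exists a, b, c; split=> //; first by rewrite -(setD1K aA) E setUA.
  by apply: contraNneq aE => ->; rewrite !inE eqxx.
by apply: contraNneq aE => ->; rewrite !inE eqxx orbT.
Qed.

Section Transport.
Variables (X Y : finType) (f : X -> Y).

(** Injectivity is asked only on [A], since the map that renames a derived design below is injective
    only off the deleted point. *)
Lemma imset_in_inj (A : {set X}) (B B' : {set X}) : {in A &, injective f} ->
  B \subset A -> B' \subset A -> f @: B = f @: B' -> B = B'.
Proof.
move=> fi BA BA' E; apply/setP => x; apply/idP/idP => xB.
  have : f x \in f @: B' by rewrite -E imset_f.
  by case/imsetP => y yB' /fi -> //; [apply: (subsetP BA) | apply: (subsetP BA')].
have : f x \in f @: B by rewrite E imset_f.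
by case/imsetP => y yB /fi -> //; [apply: (subsetP BA') | apply: (subsetP BA)].
Qed.

Lemma imset_in_sub (A : {set X}) (B B' : {set X}) : {in A &, injective f} ->
  B \subset A -> B' \subset A -> (f @: B \subset f @: B') = (B \subset B').
Proof.
move=> fi BA BA'; apply/idP/idP => [|]; last exact: imsetS.
move=> /subsetP s; apply/subsetP => x xB.
have /imsetP[y yB' /fi ->//] := s _ (imset_f f xB).
  exact: (subsetP BA).
exact: (subsetP BA').
Qed.

Lemma card_imset_blocks (A : {set X}) (Bs : {set {set X}}) (T : {set X}) :
  {in A &, injective f} -> T \subset A -> {in Bs, forall B : {set X}, B \subset A} ->
  #|[set B in [set f @: B | B : {set X} in Bs] | f @: T \subset B]|
  = #|[set B in Bs | T \subset B]|.
Proof.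
move=> fi TA BA; rewrite -(card_in_imset (f := fun B : {set X} => f @: B)); last first.
  move=> B B'; rewrite !inE => /andP[BB _] /andP[BB' _].
  by apply: (imset_in_inj fi); apply: BA.
apply: eq_card => B; rewrite inE; apply/andP/imsetP => [[/imsetP[B' BB' ->]]|[B']].
  by rewrite (imset_in_sub fi TA (BA _ BB')) => TB'; exists B'; rewrite ?inE ?BB'.
by rewrite inE => /andP[BB' TB'] ->; rewrite imset_f // (imset_in_sub fi TA (BA _ BB')).
Qed.

Lemma preim_in (A : {set X}) (T : {set Y}) : T \subset f @: A ->
  exists2 T' : {set X}, T' \subset A & T = f @: T'.
Proof.
move=> TA; exists (A :&: f @^-1: T); first exact: subsetIl.
apply/setP => y; apply/idP/imsetP => [yT|[x]]; last by rewrite !inE => /andP[_ ?] ->.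
have /imsetP[x xA E] := subsetP TA y yT.
by exists x; rewrite // !inE xA -E.
Qed.

Lemma STS_imset (A : {set X}) (Bs : {set {set X}}) : {in A &, injective f} ->
  is_STS A Bs -> is_STS (f @: A) [set f @: B | B : {set X} in Bs].
Proof.
move=> fi [blk pair]; split=> [_ /imsetP[B /blk[BA B3] ->]|P PA P2].
  rewrite card_in_imset //; first by rewrite imsetS.
  by move=> x y /(subsetP BA) xA /(subsetP BA) yA; apply: fi.
have [P' PA' E] := preim_in PA; rewrite E (card_imset_blocks fi) //.
  by apply: pair; rewrite // -P2 E card_in_imset // => x y /(subsetP PA') xA /(subsetP PA') yA; apply: fi.
by move=> B /blk[].
Qed.

Lemma r_colorable_imset (A : {set X}) (Bs : {set {set X}}) r : {in A &, injective f} ->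
  {in Bs, forall B : {set X}, B \subset A} ->
  r_colorable Bs r -> r_colorable [set f @: B | B : {set X} in Bs] r.
Proof.
(* Points outside [A] may land in an image as well, so the preimage is cut down to [A]. *)
move=> fi BA [c cP]; exists (fun B : {set Y} => c (A :&: f @^-1: B)).
have K (B : {set X}) : B \in Bs -> A :&: f @^-1: (f @: B) = B.
  move=> /BA BsA; apply/setP => x; rewrite !inE; apply/andP/idP => [[xA]|xB].
    by case/imsetP => y yB /fi ->//; apply: (subsetP BsA).
  by rewrite (subsetP BsA) // imset_f.
move=> _ _ /imsetP[B1 B1s ->] /imsetP[B2 B2s ->] nB; rewrite !K // => E.
have nB' : B1 != B2 by apply: contraNneq nB => ->.
have := cP _ _ B1s B2s nB' E; rewrite -!setI_eq0 => /eqP D.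
apply/eqP/setP => y; rewrite !inE; apply/negP => /andP[/imsetP[x1 x1B ->] /imsetP[x2 x2B]].
move=> /fi E'; have : x1 \in B1 :&: B2.
  by rewrite inE x1B E' //; [apply: (subsetP (BA _ B1s)) | apply: (subsetP (BA _ B2s))].
by rewrite D inE.
Qed.

Lemma SQS_imset (Bs : {set {set X}}) : bijective f -> is_SQS Bs ->
  is_SQS [set f @: B | B : {set X} in Bs].
Proof.
move=> fb [blk triple]; have fi := bij_inj fb; split=> [_ /imsetP[B /blk B4 ->]|T T3].
  by rewrite card_imset.
have fS : T \subset f @: setT.
  case: fb => g fK gK; apply/subsetP => y _; rewrite -(gK y); exact: imset_f.
have [T' _ E] := preim_in fS.
rewrite E (@card_imset_blocks setT) //; first by apply: triple; rewrite -T3 E card_imset.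
  exact: in2W.
Qed.

Lemma derived_imset (Bs : {set {set X}}) x : injective f ->
  derived [set f @: B | B : {set X} in Bs] (f x)
  = [set f @: B | B : {set X} in derived Bs x].
Proof.
move=> fi; have D (B : {set X}) : f @: B :\ f x = f @: (B :\ x).
  apply/setP => y; rewrite !inE; apply/andP/imsetP => [[yx /imsetP[z zB E]]|[z]].
    by exists z; rewrite // !inE zB andbT; apply: contraNneq yx => <-; rewrite E.
  by rewrite !inE => /andP[zx zB] ->; rewrite (inj_eq fi) zx imset_f.
apply/setP => B; apply/imsetP/imsetP => -[B1].
  rewrite inE => /andP[/imsetP[B2 B2s EB1] xB1] EB; subst B1 B.
  have xB : x \in B2 by move: xB1; rewrite mem_imset.
  by exists (B2 :\ x); rewrite ?D //; apply/imsetP; exists B2; rewrite // inE B2s.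
case/imsetP => B2; rewrite inE => /andP[B2s xB] -> ->.
by exists (f @: B2); rewrite ?D // inE !imset_f.
Qed.

End Transport.

(** * The chromatic index of STS(2q+1) *)

(** Deleting [x] maps the blocks through [x |: P] bijectively onto the derived blocks through
    [P]. *)
Lemma derived_STS (X : finType) (Bs : {set {set X}}) x :
  is_SQS Bs -> is_STS [set~ x] (derived Bs x).
Proof.
move=> [blk triple]; split=> [A /imsetP[B]|P Px P2].
  rewrite inE => /andP[Bs_B xB] ->; split; first by rewrite setDE subsetIr.
  by have := blk _ Bs_B; rewrite (cardsD1 x) xB => -[].
have xP : x \notin P by apply/negP => /(subsetP Px); rewrite !inE eqxx.
rewrite -(triple (x |: P)); last by rewrite cardsU1 xP P2.
rewrite -[RHS](card_in_imset (f := fun B : {set X} => B :\ x)); last first.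
  move=> B B'; rewrite !inE => /andP[_ sB] /andP[_ sB'] E.
  have xB : x \in B by apply: (subsetP sB); exact: setU11.
  have xB' : x \in B' by apply: (subsetP sB'); exact: setU11.
  by rewrite -(setD1K xB) E setD1K.
apply: eq_card => B; rewrite inE; apply/andP/imsetP => [[/imsetP[B']]|[B']].
  rewrite inE => /andP[Bs_B xB] -> PB; exists B' => //.
  rewrite inE Bs_B /=; apply/subsetP => y; rewrite !inE => /orP[/eqP->//|yP].
  by have := subsetP PB y yP; rewrite !inE => /andP[].
rewrite inE => /andP[Bs_B sB] ->; split.
  by apply/imsetP; exists B'; rewrite // inE Bs_B (subsetP sB) // setU11.
apply/subsetP => y yP; rewrite !inE (subsetP sB) ?inE ?yP ?orbT // andbT.
by apply: contraNneq xP => <-.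
Qed.

Section LowerBound.
Variables (X : finType) (Bs : {set {set X}}) (q s : nat).
Hypothesis sts : is_STS [set: X] Bs.
Hypothesis cardX : #|X| = q.*2.+1.
Hypothesis col : r_colorable Bs s.

Lemma STS_block x y : x != y -> exists2 B, B \in Bs & (x \in B) && (y \in B).
Proof.
move=> xy; have [_ /(_ [set x; y] (subsetT _))] := sts; rewrite cards2 xy => /(_ erefl) E.
have /card_gt0P[B] : 0 < #|[set B in Bs | [set x; y] \subset B]| by rewrite E.
rewrite inE => /andP[BB /subsetP sB]; exists B => //.
by rewrite !sB // !inE eqxx ?orbT.
Qed.

Lemma STS_block_inj x y B B' : x != y -> B \in Bs -> B' \in Bs ->
  x \in B -> y \in B -> x \in B' -> y \in B' -> B = B'.
Proof.
move=> xy BB BB' xB yB xB' yB'.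
have [_ /(_ [set x; y] (subsetT _))] := sts; rewrite cards2 xy => /(_ erefl)/eqP/cards1P[A EA].
have /set1P -> : B \in [set A].
  by rewrite -EA inE BB; apply/subsetP => z; rewrite !inE => /orP[]/eqP->.
suff /set1P -> : B' \in [set A] by [].
by rewrite -EA inE BB'; apply/subsetP => z; rewrite !inE => /orP[]/eqP->.
Qed.

(** The blocks through [x], with [x] removed, partition the other 2q points into pairs. *)
Lemma STS_degree x : #|[set B in Bs | x \in B]| = q.
Proof.
have [blk _] := sts; pose Px := [set B :\ x | B in [set B in Bs | x \in B]].
have in_star B : B \in [set B in Bs | x \in B] -> B \in Bs /\ x \in B.
  by rewrite inE => /andP[].
have part : partition Px [set~ x].
  apply/and3P; split.
  - apply/eqP/setP => y; rewrite !inE; apply/bigcupP/idP => [[_ /imsetP[B _ ->]]|yx].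
      by rewrite !inE => /andP[].
    have [|B BB /andP[xB yB]] := @STS_block x y; first by rewrite eq_sym.
    by exists (B :\ x); rewrite ?inE ?yx //; apply: imset_f; rewrite inE BB.
  - apply/trivIsetP => _ _ /imsetP[B /in_star[BB xB] ->] /imsetP[B' /in_star[BB' xB'] ->] nB.
    rewrite -setI_eq0; apply/eqP/setP => y; rewrite !inE; apply/negP.
    case/andP => /andP[yx yB] /andP[_ yB']; case/negP: nB.
    by rewrite (@STS_block_inj x y B B') // eq_sym.
  - apply/imsetP => -[B /in_star[BB xB]] E.
    by have [_] := blk _ BB; rewrite (cardsD1 x) xB -E cards0.
have U : {in Px, forall A : {set X}, #|A| = 2}.
  move=> _ /imsetP[B /in_star[BB xB] ->].
  by have [_] := blk _ BB; rewrite (cardsD1 x) xB => -[].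
have := card_uniform_partition U part; rewrite cardsC1 cardX /=.
rewrite card_in_imset => [|B B' /in_star[BB xB] /in_star[BB' xB'] E].
  by rewrite -muln2 => /eqP; rewrite eqn_pmul2r // => /eqP.
by rewrite -(setD1K xB) E setD1K.
Qed.

Lemma STS_color_bound : 3 %| q -> q < s.
Proof.
move=> q3; have [blk _] := sts; case: col => c cP; rewrite ltnNge; apply/negP => sq.
have ci x : {in [set B in Bs | x \in B] &, injective c}.
  move=> B B'; rewrite !inE => /andP[BB xB] /andP[BB' xB'] E; apply/eqP/idPn => nB.
  by have /disjointFr/(_ xB) := cP _ _ BB BB' nB E; rewrite xB'.
have [x0 _] : exists x : X, x \in X by apply/card_gt0P; rewrite cardX.
have qs : q <= s by rewrite -[s]card_ord -(STS_degree x0) -(card_in_imset (ci x0)) max_card.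
(* The [q] blocks through a point have distinct colors and [s] is at most [q], so every color occurs
   at every point. Each color class is then a partition into triples. *)
have csurj x k : exists2 B, B \in Bs & (x \in B) && (c B == k).
  have E : c @: [set B in Bs | x \in B] = setT.
    by apply/eqP; rewrite eqEcard subsetT cardsT card_ord card_in_imset ?STS_degree.
  have : k \in c @: [set B in Bs | x \in B] by rewrite E inE.
  case/imsetP => B; rewrite inE => /andP[BB xB] ->.
  by exists B; rewrite // xB eqxx.
have s0 : 0 < s by case: (s) c {ci csurj cP} => // c; case: (c set0).
pose k : 'I_s := Ordinal s0.
have part : partition [set B in Bs | c B == k] [set: X].
  apply/and3P; split.
  - apply/eqP/setP => y; rewrite inE; apply/bigcupP.
    by have [B BB /andP[yB cB]] := csurj y k; exists B; rewrite // inE BB.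
  - apply/trivIsetP => B B'; rewrite !inE => /andP[BB /eqP cB] /andP[BB' /eqP cB'] nB.
    by apply: cP; rewrite // cB.
  - rewrite inE; apply/negP => /andP[/blk[_]]; by rewrite cards0.
have U : {in [set B in Bs | c B == k], forall A : {set X}, #|A| = 3}.
  by move=> B; rewrite inE => /andP[/blk[]].
have := card_uniform_partition U part; rewrite cardsT cardX => E.
have : 3 %| q.*2.+1 by rewrite E dvdn_mull.
by rewrite -muln2 -(addn1 (q * 2)) dvdn_addr ?dvdn_mulr.
Qed.

End LowerBound.

(** The lower bound holds for every STS(2q+1), and a derived design, copied to an ordinal, attains
    it; so q+1 is the chromatic index. *)
Lemma mcDSQS_of_colorable (X : finType) (Bs : {set {set X}}) q : 3 %| q ->
  #|X| = q.*2.+2 -> is_SQS Bs -> (forall x, r_colorable (derived Bs x) q.+1) ->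
  is_mcDSQS Bs.
Proof.
move=> q3 cX sqs col; split=> // x; split; first exact: derived_STS.
have sts := derived_STS x sqs.
exists q.+1; split=> //.
have cx : #|[set~ x]| = q.*2.+1 by rewrite cardsC1 cX.
split; last first.
  move=> Bs' s sts' col'; apply: (STS_color_bound sts' _ col' q3).
  by rewrite card_ord.
have [y yx] : exists y, y \in [set~ x] by apply/card_gt0P; rewrite cx.
pose f := enum_rank_in yx.
have fi : {in [set~ x] &, injective f} := can_in_inj (enum_rankK_in yx).
have ET : f @: [set~ x] = [set: 'I_#|[set~ x]|].
  by apply/eqP; rewrite eqEcard subsetT cardsT card_ord card_in_imset //=.
exists [set f @: B | B : {set X} in derived Bs x]; split.
  by rewrite -ET; apply: STS_imset.
by apply: (r_colorable_imset fi _ (col x)) => B BB; case: (proj1 sts B BB).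
Qed.

(** The construction lives on a set of pairs. This carries it to any point set of the same size,
    where each derived design is the image of an old one. *)
Lemma mcDSQS_transport (X Y : finType) (Bs : {set {set X}}) q : 3 %| q ->
  #|X| = q.*2.+2 -> #|Y| = #|X| -> is_SQS Bs ->
  (forall x, r_colorable (derived Bs x) q.+1) ->
  exists Bs' : {set {set Y}}, is_mcDSQS Bs'.
Proof.
move=> q3 cX cY sqs col.
have [f fb] : exists f : X -> Y, bijective f.
  exists (fun x => enum_val (cast_ord (esym cY) (enum_rank x))).
  exists (fun y => enum_val (cast_ord cY (enum_rank y))) => z;
    by rewrite enum_valK ?cast_ordK ?cast_ordKV enum_rankK.
have fi := bij_inj fb.
exists [set f @: B | B : {set X} in Bs].
apply: (mcDSQS_of_colorable q3); rewrite ?cY //; first exact: SQS_imset.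
case: fb => g fK gK y; rewrite -(gK y) derived_imset //.
by apply: (@r_colorable_imset _ _ _ setT) => //; apply: in2W.
Qed.

(** * Gluing systems on circles *)

Section Gluing.
Variables (P D : finType) (circles : {set {set P}}) (dir : P -> {set P} -> D).
Hypothesis circle_ex : forall T : {set P}, #|T| = 3 ->
  exists2 C, C \in circles & T \subset C.
Hypothesis circle_inj : forall (T C C' : {set P}), #|T| = 3 ->
  C \in circles -> C' \in circles -> T \subset C -> T \subset C' -> C = C'.
Hypothesis card_circle : forall C, C \in circles -> #|C| = 10.
(** Away from [x], the circles through [x] are the lines of an affine space, and [dir x C] is the
    direction of such a line. *)
Hypothesis par_ex : forall x y C, C \in circles -> x \in C -> y != x ->
  exists2 C', C' \in circles & [/\ x \in C', y \in C' & dir x C' = dir x C].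
Hypothesis par_inj : forall x y C C', C \in circles -> C' \in circles ->
  x \in C -> x \in C' -> y \in C -> y \in C' -> y != x ->
  dir x C = dir x C' -> C = C'.

Notation Q := (P * bool)%type.
(* At p, kap colors the blocks of the circles through p.1 and o p.1, and rho
   those of the other circles through p.1. *)
Variables (o : P -> P) (H : {set P} -> {set {set Q}}).
Variables (kap : {set P} -> Q -> {set Q} -> P) (rho : {set P} -> Q -> {set Q} -> 'I_8).
Hypothesis o_neq : forall x, o x != x.
(** [H C] holds the blocks on [C] that meet every fiber at most once. The unions of two fibers are
    shared by all circles and enter in [glued]. *)
Hypothesis H_card : forall C B, C \in circles -> B \in H C -> #|B| = 4.
Hypothesis H_inj : forall C B, C \in circles -> B \in H C -> {in B &, injective fst}.
Hypothesis H_sub : forall C B, C \in circles -> B \in H C -> {in B, forall p, p.1 \in C}.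
Hypothesis H_triple : forall C (T : {set Q}), C \in circles -> #|T| = 3 ->
  {in T &, injective fst} -> {in T, forall p, p.1 \in C} ->
  #|[set B in H C | T \subset B]| = 1.

(** For two blocks through [p], this is disjointness of their traces in the derived design at
    [p]. *)
Definition meet_only (T : finType) (p : T) (B B' : {set T}) :=
  forall q, q \in B -> q \in B' -> q = p.

(** A value [b] other than [p.1] names the class that contains the block of the fiber of [b], so by
    [kap_out] the block must avoid that fiber. The value [p.1] names the class D, and [kap_avoid]
    keeps D off the fiber of [o p.1]. *)
Hypothesis kap_in : forall C p B, C \in circles -> o p.1 \in C ->
  B \in H C -> p \in B -> kap C p B \in C.
Hypothesis kap_out : forall C p B q, C \in circles -> o p.1 \in C ->
  B \in H C -> p \in B -> q \in B -> q != p -> kap C p B != q.1.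
Hypothesis kap_avoid : forall C p B q, C \in circles -> o p.1 \in C ->
  B \in H C -> p \in B -> q \in B -> kap C p B = p.1 -> q.1 != o p.1.
Hypothesis kap_proper : forall C p B B', C \in circles -> o p.1 \in C ->
  B \in H C -> B' \in H C -> p \in B -> p \in B' -> B != B' ->
  kap C p B = kap C p B' -> meet_only p B B'.
Hypothesis rho_proper : forall C p B B', C \in circles -> o p.1 \notin C ->
  B \in H C -> B' \in H C -> p \in B -> p \in B' -> B != B' ->
  rho C p B = rho C p B' -> meet_only p B B'.

Definition fibers (a b : P) : {set Q} := setX [set a; b] setT.

Lemma in_fibers a b p : (p \in fibers a b) = (p.1 == a) || (p.1 == b).
Proof. by case: p => u i; rewrite !inE andbT. Qed.

Definition glued : {set {set Q}} :=
  [set B | [exists C in circles, B \in H C] ||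
           [exists a, exists b, (a != b) && (B == fibers a b)]].

Variant glued_spec (B : {set Q}) : Prop :=
  | GluedCircle C of C \in circles & B \in H C
  | GluedFibers a b of a != b & B = fibers a b.

Lemma gluedP B : B \in glued -> glued_spec B.
Proof.
rewrite inE => /orP[/existsP[C /andP[]]|/existsP[a /existsP[b /andP[ab /eqP]]]].
  exact: GluedCircle.
exact: GluedFibers.
Qed.

Lemma glued_circle C B : C \in circles -> B \in H C -> B \in glued.
Proof. by move=> CC BH; rewrite inE; apply/orP; left; apply/existsP; exists C; rewrite CC. Qed.

Lemma glued_fibers a b : a != b -> fibers a b \in glued.
Proof.
move=> ab; rewrite inE; apply/orP; right; apply/existsP; exists a; apply/existsP.
by exists b; rewrite ab eqxx.
Qed.

Lemma card_fst (T : {set Q}) : {in T &, injective fst} -> #|fst @: T| = #|T|.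
Proof. exact: card_in_imset. Qed.

(** A triple over three points of [P] lies over exactly one circle, whose system has one block for
    it. A triple containing a whole fiber lies only in the union of that fiber and the one of its
    third point. *)
Lemma glued_SQS : is_SQS glued.
Proof.
split=> [B /gluedP[C CC /(H_card CC)//|a b ab ->]|T T3].
  by rewrite cardsX cards2 ab cardsT card_bool.
apply/eqP/cards1P.
have [inj|] := boolP [forall p in T, forall q in T, (p.1 == q.1) ==> (p == q)].
  have Ti : {in T &, injective fst}.
    move=> p q pT qT /eqP E; apply/eqP; move/forall_inP: inj => /(_ p pT)/forall_inP/(_ q qT).
    by rewrite E.
  have T3' : #|fst @: T| = 3 by rewrite card_fst.
  have [C CC TC] := circle_ex T3'.
  have TC' : {in T, forall p, p.1 \in C}.
    by move=> p pT; apply: (subsetP TC); apply: imset_f.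
  have /eqP/cards1P[B EB] := H_triple CC T3 Ti TC'.
  have /setIdP[BH TB] : B \in [set B in H C | T \subset B] by rewrite EB set11.
  exists B; apply/setP => B'; rewrite in_set1 inE; apply/andP/eqP => [[]|->]; last first.
    by split=> //; apply: glued_circle BH.
  case/gluedP => [C' CC' B'H TB'|a b ab -> TB'].
    have E : C' = C.
      apply: (circle_inj T3') => //; apply/subsetP => _ /imsetP[p pT ->].
      by apply: H_sub B'H _ _ => //; apply: (subsetP TB').
    apply/eqP; rewrite -in_set1 -EB inE -E.
    by move: B'H; rewrite E => ->.
  (* A union of two fibers projects to two points only, hence cannot contain [T]. *)
  have : #|fst @: T| <= #|[set a; b]|.
    apply/subset_leq_card/subsetP => _ /imsetP[p pT ->].
    by have := subsetP TB' p pT; rewrite in_fibers !inE.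
  by rewrite T3' cards2 ab.
rewrite negb_forall_in => /exists_inP[[a i] pT].
rewrite negb_forall_in => /exists_inP[[a' j] qT]; rewrite negb_imply /=.
case/andP => /eqP E; subst a' => ij.
have pq : (a, j) != (a, i) by rewrite eq_sym.
have T2 : #|T :\ (a, i) :\ (a, j)| = 1.
  by move: T3; rewrite (cardsD1 (a, i)) pT (cardsD1 (a, j)) !inE pq qT => -[].
have /cards1P[[b k] ET] : #|T :\ (a, i) :\ (a, j)| == 1 by rewrite T2.
have /and3P[rj ri rT] : [&& (b, k) != (a, j), (b, k) != (a, i) & (b, k) \in T].
  by have := set11 (b, k); rewrite -ET !inE.
(* A third point over [a] is impossible, because a fiber has two points. *)
have ab : a != b.
  apply: contraNneq rj => E; rewrite -E; move: ri; rewrite -E !xpair_eqE eqxx /=.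
  by move: ij; rewrite xpair_eqE eqxx; case: (i) (j) (k) => [] [] [].
exists (fibers a b); apply/setP => B; rewrite in_set1 inE.
apply/andP/eqP => [[/gluedP[C CC BH TB|a' b' ab' -> TB]]|->].
- by have := H_inj CC BH (subsetP TB _ pT) (subsetP TB _ qT) erefl; move/eqP; rewrite (negPf ij).
- congr (setX _ _); apply/esym/eqP; rewrite eqEcard !cards2 ab ab' leqnn andbT.
  apply/subsetP => u; rewrite !inE => /orP[]/eqP->.
    by have := subsetP TB _ pT; rewrite in_fibers.
  by have := subsetP TB _ rT; rewrite in_fibers.
- split; first exact: glued_fibers.
  apply/subsetP => -[u l] uT; rewrite in_fibers /=.
  have [uj|uj] := eqVneq (u, l) (a, j); first by case: uj => ->; rewrite eqxx.
  have [ui|ui] := eqVneq (u, l) (a, i); first by case: ui => ->; rewrite eqxx.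
  have : (u, l) \in T :\ (a, i) :\ (a, j) by rewrite !inE ui uj.
  by rewrite ET inE => /eqP[-> _]; rewrite eqxx orbT.
Qed.

(** The cases are a circle through [o x], any other circle through [x], and a union of two fibers.
    In the second case [C'] is the parallel to [C] through [o x], and [rho] selects one of its eight
    points other than [x] and [o x]. The defaults [x] are never reached for blocks of [glued]
    through [p]. *)
Definition color (p : Q) (B : {set Q}) : P :=
  let x := p.1 in
  if [pick C in circles | B \in H C] is Some C then
    if o x \in C then kap C p B
    else if [pick C' in circles | [&& x \in C', o x \in C' & dir x C' == dir x C]]
      is Some C' then nth x (enum (C' :\: [set x; o x])) (rho C p B) else x
  else odflt x [pick b | (b != x) && (B == fibers x b)].

Variant color_spec (p : Q) (B : {set Q}) (c : P) : Prop :=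
  | ColorSpecial C of C \in circles & B \in H C & o p.1 \in C & c = kap C p B
  | ColorParallel C C' of C \in circles & B \in H C & o p.1 \notin C &
      C' \in circles & p.1 \in C' & o p.1 \in C' & dir p.1 C' = dir p.1 C &
      c = nth p.1 (enum (C' :\: [set p.1; o p.1])) (rho C p B)
  | ColorFibers of c != p.1 & B = fibers p.1 c.

Lemma colorP p B : B \in glued -> p \in B -> color_spec p B (color p B).
Proof.
move=> BG pB; rewrite /color; case: pickP => [C /andP[CC BH]|noC].
  have xC : p.1 \in C := H_sub CC BH pB.
  case: ifP => [oC|/negbT oC]; first exact: (@ColorSpecial _ _ _ C).
  case: pickP => [C' /andP[CC' /and3P[xC' oC' /eqP D']]|no].
    exact: (@ColorParallel _ _ _ C C').
  have [C' CC' [xC' oC' D']] := par_ex CC xC (o_neq p.1).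
  by have := no C'; rewrite CC' xC' oC' D' eqxx.
case: pickP => [b /andP[bx /eqP E]|no]; first exact: ColorFibers.
case/gluedP: BG => [C CC BH|a b ab E]; first by have := noC C; rewrite CC BH.
move: pB; rewrite E in_fibers => /orP[]/eqP pE.
  by move/(_ b)/negbT: no; rewrite negb_and pE E eqxx orbF negbK eq_sym (negPf ab).
by move/(_ a)/negbT: no; rewrite negb_and pE E /fibers setUC eqxx orbF ab.
Qed.

Lemma circle_eq3 x y z C C' : C \in circles -> C' \in circles ->
  x \in C -> x \in C' -> y \in C -> y \in C' -> z \in C -> z \in C' ->
  x != y -> x != z -> y != z -> C = C'.
Proof.
move=> CC CC' xC xC' yC yC' zC zC' xy xz yz.
apply: (@circle_inj [set x; y; z]) => //.
- by rewrite -setUA cardsU1 cards2 yz !inE negb_or xy xz.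
- by apply/subsetP => u; rewrite !inE => /orP[/orP[]|] /eqP ->.
- by apply/subsetP => u; rewrite !inE => /orP[/orP[]|] /eqP ->.
Qed.

Lemma size_transversal x C : C \in circles -> x \in C -> o x \in C ->
  size (enum (C :\: [set x; o x])) = 8.
Proof.
move=> CC xC oC; rewrite -cardE cardsD card_circle // (setIidPr _).
  by rewrite cards2 eq_sym o_neq.
by apply/subsetP => u; rewrite !inE => /orP[]/eqP->.
Qed.

Lemma color_parallel_mem x C (k : 'I_8) : C \in circles -> x \in C -> o x \in C ->
  let c := nth x (enum (C :\: [set x; o x])) k in
  [/\ c \in C, c != x & c != o x].
Proof.
move=> CC xC oC c; have : c \in enum (C :\: [set x; o x]).
  by rewrite mem_nth // size_transversal.
by rewrite mem_enum !inE negb_or => /andP[/andP[-> ->] ->].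
Qed.

Lemma meet_only_sym (T : finType) (p : T) B B' : meet_only p B B' -> meet_only p B' B.
Proof. by move=> h q qB qB'; apply: h. Qed.

(** The kinds of the two blocks give nine cases, reduced by symmetry. A common point besides [p]
    makes the circles involved share three points, or makes two parallels meet, so that they
    coincide; on a single circle [kap] and [rho] are proper. *)
Lemma color_proper p B B' : B \in glued -> B' \in glued -> p \in B -> p \in B' ->
  B != B' -> color p B = color p B' -> meet_only p B B'.
Proof.
move=> BG BG' pB pB' BB' E.
have fst_neq C A q : C \in circles -> A \in H C -> p \in A -> q \in A ->
    q != p -> q.1 != p.1.
  by move=> CC AH pA qA; apply: contraNneq => /(H_inj CC AH qA pA) ->.
(* A circle through [o p.1] against a union of fibers: [kap_out] keeps the other points of the block
   off the fiber of its color. *)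
have FS A A' c C : A \in H C -> C \in circles -> o p.1 \in C -> p \in A ->
    A' = fibers p.1 c -> c = kap C p A -> meet_only p A A'.
  move=> AH CC oC pA -> -> q qA; rewrite in_fibers; apply: contraTeq => qp.
  by rewrite negb_or (fst_neq C A) //= eq_sym kap_out.
(* A circle missing [o p.1] against a union of fibers: a common point besides [p] would lie over
   [c], on both parallels [C] and [C'], and force [C = C'], which contains [o p.1]. *)
have FN A A' c C C' : A \in H C -> C \in circles -> o p.1 \notin C -> p \in A ->
    A' = fibers p.1 c -> C' \in circles -> p.1 \in C' -> o p.1 \in C' ->
    dir p.1 C' = dir p.1 C -> c \in C' -> meet_only p A A'.
  move=> AH CC oC pA -> CC' xC' oC' D' cC' q qA; rewrite in_fibers.
  apply: contraTeq => qp; have qx := fst_neq _ _ _ CC AH pA qA qp.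
  rewrite negb_or qx /=; apply: contraNneq oC => qc.
  have -> // : C = C'; apply: (par_inj CC CC' _ xC' _ _ qx (esym D')).
  - exact: H_sub pA.
  - exact: H_sub qA.
  - by rewrite qc.
(* A circle [C] through [o p.1] against a circle [C1] missing it: [C] and [C'] share [p.1], [o p.1]
   and the color, so they are equal. Then [C1] is parallel to [C] and cannot meet it again. *)
have SN A A' C C1 C' : A \in H C -> C \in circles -> o p.1 \in C -> p \in A ->
    A' \in H C1 -> C1 \in circles -> o p.1 \notin C1 -> p \in A' -> C' \in circles ->
    p.1 \in C' -> o p.1 \in C' -> dir p.1 C' = dir p.1 C1 ->
    kap C p A \in C' -> kap C p A != p.1 -> kap C p A != o p.1 -> meet_only p A A'.
  move=> AH CC oC pA AH' CC1 oC1 pA' CC' xC' oC' D' cC' cx co q qA qA'.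
  apply: contraNeq oC1 => qp; have qx := fst_neq _ _ _ CC AH pA qA qp.
  have EC : C = C'.
    apply: (@circle_eq3 p.1 (o p.1) (kap C p A)) => //; try by rewrite eq_sym.
      exact: H_sub pA.
    exact: kap_in.
  have -> // : C1 = C; apply: (par_inj CC1 CC _ _ _ _ qx); rewrite ?EC //.
  - exact: H_sub pA'.
  - exact: H_sub qA'.
  - by rewrite -EC; apply: H_sub qA.
case: (colorP BG pB) E => [C CC BH oC ->|C C' CC BH oC CC' xC' oC' D' ->|cx EB];
  case: (colorP BG' pB') => [C1 CC1 BH1 oC1 ->|C1 C1' CC1 BH1 oC1 CC1' xC1' oC1' D1' ->|cx1 EB1] E.
- have [EC|nC] := eqVneq C C1; first by subst C1; apply: kap_proper E.
  move=> q qB qB'; apply: contraNeq nC => qp.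
  have qx := fst_neq _ _ _ CC BH pB qB qp.
  have xC := H_sub CC BH pB; have xC1 := H_sub CC1 BH1 pB'.
  (* Distinct circles through [p.1] and [o p.1] have no third common point, so [q] lies over
     [o p.1]. The common color is then either a third common point after all, or the name of D,
     which misses that fiber. *)
  have [qo|qo] := eqVneq q.1 (o p.1); last first.
    apply/eqP/(@circle_eq3 p.1 (o p.1) q.1) => //; try by rewrite eq_sym.
      exact: H_sub qB.
    exact: H_sub qB'.
  have cC := kap_in CC oC BH pB; have cC1 : kap C p B \in C1 by rewrite E; apply: kap_in.
  have [cx|cx] := eqVneq (kap C p B) p.1.
    by have := kap_avoid CC oC BH pB qB cx; rewrite qo eqxx.
  apply/eqP/(@circle_eq3 p.1 (o p.1) (kap C p B)) => //; try by rewrite eq_sym.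
  by rewrite -qo eq_sym kap_out.
- have [cC1 cx co] := color_parallel_mem (rho C1 p B') CC1' xC1' oC1'.
  by apply: (SN _ _ C C1 C1') => //; rewrite E.
- exact: (FS _ _ _ C _ _ _ _ EB1 (esym E)).
- have [cC cx co] := color_parallel_mem (rho C p B) CC' xC' oC'.
  by apply/meet_only_sym/(SN _ _ C1 C C') => //; rewrite -E.
- have [cC cx co] := color_parallel_mem (rho C p B) CC' xC' oC'.
  have [] := color_parallel_mem (rho C1 p B') CC1' xC1' oC1'; rewrite -E => cC1 _ _.
  (* The common color is a third common point of [C'] and [C1']. Hence [C] and [C1] have the same
     direction, and they meet in [q.1]. *)
  have EC' : C' = C1'.
    by apply: (circle_eq3 CC' CC1' xC' xC1' oC' oC1' cC cC1); rewrite eq_sym ?o_neq.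
  move=> q qB qB'; apply: contraNeq BB' => qp.
  have qx := fst_neq _ _ _ CC BH pB qB qp.
  have EC : C = C1.
    apply: (par_inj CC CC1 _ _ _ _ qx); rewrite -?D' -?D1' ?EC' //.
    - exact: H_sub pB.
    - exact: H_sub pB'.
    - exact: H_sub qB.
    - exact: H_sub qB'.
  (* Equal colors are now equal entries of one enumeration without repetitions, so the indices given
     by [rho] agree. *)
  subst C1; subst C1'; move: qp; apply: contraNT => nBB'; apply/eqP.
  apply: (rho_proper CC oC BH BH1) qB qB' => //; apply/val_inj/eqP.
  have U := enum_uniq (C' :\: [set p.1; o p.1]).
  rewrite -(nth_uniq p.1 _ _ U) ?size_transversal ?ltn_ord //.
  by rewrite E.
- have [cC cx co] := color_parallel_mem (rho C p B) CC' xC' oC'.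
  by apply: (FN _ _ _ C C' BH CC oC pB EB1) => //; rewrite -E.
- by apply/meet_only_sym/(FS _ _ _ C1 _ _ _ _ EB E).
- have [cC cx' co] := color_parallel_mem (rho C1 p B') CC1' xC1' oC1'.
  by apply/meet_only_sym/(FN _ _ _ C1 C1' BH1 CC1 oC1 pB' EB) => //; rewrite E.
- by move: BB'; rewrite EB EB1 E eqxx.
Qed.

Lemma glued_colorable p : r_colorable (derived glued p) #|P|.
Proof.
(* Adding [p] back restores the block of [glued]. *)
exists (fun B => enum_rank (color p (p |: B))) => B1 B2.
case/imsetP => A1; rewrite inE => /andP[A1G pA1] ->.
case/imsetP => A2; rewrite inE => /andP[A2G pA2] ->.
rewrite !setD1K // => nA /enum_rank_inj E; rewrite -setI_eq0.
apply/eqP/setP => q; rewrite !inE; apply/negP => /andP[/andP[qp q1] /andP[_ q2]].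
have nA' : A1 != A2 by apply: contraNneq nA => ->.
by have := color_proper A1G A2G pA1 pA2 nA' E q1 q2; move/eqP; rewrite (negPf qp).
Qed.

End Gluing.

(** * Three systems on 20 points *)

(* The point (g, i) of the 20-point set is coded by 2g + i. A table lists the
   blocks meeting every fiber at most once (the other blocks are the unions of
   two fibers) and, for each point x, the colors of the blocks through x in the
   order of the list. If mode is Some o at the fiber of x, a color is a label g:
   it names the class containing the block of x with its partner and the fiber
   of g, or, if g is the label of x, the class D, which avoids the fiber of o.
   If mode is None, the colors are the indices of 8 parallel classes. *)
Definition blocks_ok (tbl : seq (seq nat)) : bool :=
  all (fun s => [&& size s == 4, uniq s, all (fun k => k < 20) s &
                 all (fun k => all (fun l => (k./2 == l./2) ==> (k == l)) s) s]) tbl.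

(** Filtering the table in stages keeps the computation small. *)
Definition triples_ok (tbl : seq (seq nat)) : bool :=
  all (fun a => let ta := [seq s <- tbl | a \in s] in
    all (fun b => let tb := [seq s <- ta | b \in s] in
      all (fun c => uniq [:: a./2; b./2; c./2] ==>
                    (size [seq s <- tb | c \in s] == 1)) (iota 0 20))
      (iota 0 20)) (iota 0 20).

Definition star (tbl : seq (seq nat)) (x : nat) := [seq s <- tbl | x \in s].

Definition special_ok (x o : nat) (z : seq (seq nat * nat)) : bool :=
  all (fun sk => (sk.2 < 10) && all (fun y => (y == x) ||
        (y./2 != sk.2) && ((sk.2 == x./2) ==> (y./2 != o))) sk.1) z.

Definition proper_ok (x : nat) (z : seq (seq nat * nat)) : bool :=
  all (fun sk => all (fun sk' : seq nat * nat => (sk.2 == sk'.2) ==> (sk.1 == sk'.1) ||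
        all (fun y => (y \in sk'.1) ==> (y == x)) sk.1) z) z.

Definition colors_ok (mode : nat -> option nat) (tbl cols : seq (seq nat)) : bool :=
  all (fun x => let z := zip (star tbl x) (nth [::] cols x) in
    [&& size (nth [::] cols x) == size (star tbl x), proper_ok x z &
        if mode x./2 is Some o then special_ok x o z
        else all (fun k => k < 8) (nth [::] cols x)]) (iota 0 20).

Definition table_ok (mode : nat -> option nat) (tbl cols : seq (seq nat)) : bool :=
  [&& blocks_ok tbl, triples_ok tbl & colors_ok mode tbl cols].

(** * Blocks and colorings read from a checked table *)

Local Notation Q0 := ('I_10 * bool)%type.

Definition code (p : Q0) : nat := p.1.*2 + p.2.
Definition decode (k : nat) : Q0 := (inord k./2, odd k).

Lemma code_half p : (code p)./2 = p.1.
Proof. by rewrite /code addnC half_bit_double. Qed.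

Lemma code_lt p : code p < 20.
Proof.
rewrite /code; case: p => -[i Hi] b /=; rewrite -addnn.
by case: b; do 10?[case: i Hi => [|i] Hi //].
Qed.

Lemma codeK : cancel code decode.
Proof.
move=> [i b]; rewrite /decode code_half /= inord_val; congr (_, _).
by rewrite /code oddD odd_double; case: b.
Qed.

Lemma decodeK k : k < 20 -> code (decode k) = k.
Proof.
move=> k20; rewrite /code /= inordK; first by rewrite addnC odd_double_half.
by rewrite -ltn_double (leq_ltn_trans _ k20) // -{2}[k]odd_double_half leq_addl.
Qed.

Lemma code_inj : injective code. Proof. exact: can_inj codeK. Qed.

Definition points (s : seq nat) : {set Q0} := [set p | code p \in s].

Lemma in_points s p : (p \in points s) = (code p \in s).
Proof. by rewrite inE. Qed.

Section Table.
Variables (mode : nat -> option nat) (tbl cols : seq (seq nat)).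
Hypothesis ok : table_ok mode tbl cols.

Definition blocks : {set {set Q0}} := [set B | has (fun s => B == points s) tbl].

Lemma blocksP B : reflect (exists2 s, s \in tbl & B = points s) (B \in blocks).
Proof.
rewrite inE; apply: (iffP hasP) => -[s sT]; first by move/eqP; exists s.
by move=> ->; exists s.
Qed.

Lemma blocks_okP s : s \in tbl ->
  [/\ size s = 4, uniq s, {in s, forall k, k < 20} &
      {in s &, forall k l, k./2 = l./2 -> k = l}].
Proof.
case/and3P: ok => /allP b _ _ /b /and4P[/eqP ? ? /allP ? /allP h]; split=> // k l ks ls E.
by apply/eqP; move/allP: (h k ks) => /(_ l ls)/implyP; apply; rewrite E.
Qed.

Lemma card_block B : B \in blocks -> #|B| = 4.
Proof.
case/blocksP => s /blocks_okP[s4 us s20 _] ->; apply: etrans s4.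
rewrite -(size_map decode) -(card_uniqP _).
  apply: eq_card => p; rewrite in_points; apply/idP/mapP => [ps|[k ks ->]].
    by exists (code p); rewrite ?codeK.
  by rewrite decodeK ?s20.
rewrite map_inj_in_uniq // => k l /s20 k20 /s20 l20 /(congr1 code).
by rewrite !decodeK.
Qed.

Lemma block_fst_inj B : B \in blocks -> {in B &, injective fst}.
Proof.
case/blocksP => s /blocks_okP[_ _ _ h] -> p q; rewrite !in_points => ps qs E.
by apply/code_inj/h; rewrite // !code_half E.
Qed.

Lemma block_triple (T : {set Q0}) : #|T| = 3 -> {in T &, injective fst} ->
  #|[set B in blocks | T \subset B]| = 1.
Proof.
move=> T3 Ti.
have [p [q [r [ET pq pr qr]]]] := set3P T3.
have [pT qT rT] : [/\ p \in T, q \in T & r \in T] by rewrite ET !inE !eqxx ?orbT.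
case/and3P: ok => _ /allP tr _.
have mem_iota20 u : code u \in iota 0 20 by rewrite mem_iota code_lt.
have U : uniq [:: (code p)./2; (code q)./2; (code r)./2].
  rewrite !code_half /= !inE negb_or !val_eqE !andbT -andbA.
  apply/and3P; split; first by apply: contraNneq pq => /(Ti _ _ pT qT) ->.
    by apply: contraNneq pr => /(Ti _ _ pT rT) ->.
  by apply: contraNneq qr => /(Ti _ _ qT rT) ->.
have := allP (allP (tr _ (mem_iota20 p)) _ (mem_iota20 q)) _ (mem_iota20 r).
rewrite U implyTb -!filter_predI => /eqP S1.
have TE s : (T \subset points s) = [&& code r \in s, code q \in s & code p \in s].
  rewrite ET; apply/subsetP/and3P => [h|[rs qs ps] u].
    by split; rewrite -in_points; apply: h; rewrite !inE eqxx ?orbT.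
  by rewrite !inE => /orP[/orP[]|] /eqP ->.
move: S1; case E: [seq _ <- _ | _] => [|s [|]] // _.
(* The filtered list is the single entry [s], so the count of list entries becomes uniqueness of the
   block. *)
have memE s' : (s' \in tbl) && (T \subset points s') = (s' == s).
  by rewrite TE andbC -mem_seq1 -E mem_filter.
apply/eqP/cards1P; exists (points s); apply/setP => B; rewrite in_set1 inE.
apply/andP/eqP => [[/blocksP[s' s'T ->] TB]|->].
  by have := memE s'; rewrite s'T TB => /esym/eqP ->.
by have := memE s; rewrite eqxx => /andP[sT ->]; split=> //; apply/blocksP; exists s.
Qed.

Definition block_color (p : Q0) (B : {set Q0}) : nat :=
  nth 0 (nth [::] cols (code p)) (find (fun s => B == points s) (star tbl (code p))).

(** Brings a block and its color into the zipped list over which the checks range. *)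
Lemma block_colorP p B : B \in blocks -> p \in B -> exists2 s, B = points s &
  (s, block_color p B) \in zip (star tbl (code p)) (nth [::] cols (code p)) /\
  block_color p B \in nth [::] cols (code p).
Proof.
case/blocksP => s0 s0T E0 pB; set st := star tbl (code p); set cs := nth [::] cols (code p).
have hs : has (fun s => B == points s) st.
  apply/hasP; exists s0; last by rewrite E0.
  by rewrite mem_filter s0T andbT -in_points -E0.
have sz : size cs = size st.
  case/and3P: ok => _ _ /allP/(_ (code p)); rewrite mem_iota code_lt => /(_ isT).
  by case/and3P => /eqP.
have lt : find (fun s => B == points s) st < size st by rewrite -has_find.
exists (nth [::] st (find (fun s => B == points s) st)); first exact/eqP/(nth_find _ hs).
rewrite /block_color -/st -/cs; split; last by rewrite mem_nth // sz.
by rewrite -nth_zip // mem_nth // size_zip sz minnn.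
Qed.

Lemma colors_okP p : let z := zip (star tbl (code p)) (nth [::] cols (code p)) in
  proper_ok (code p) z /\
  is_true (if mode p.1 is Some o then special_ok (code p) o z
           else all (fun k => k < 8) (nth [::] cols (code p))).
Proof.
move=> z; case/and3P: ok => _ _ /allP/(_ (code p)); rewrite mem_iota code_lt => /(_ isT).
by case/and3P => _ h1; rewrite code_half => h2; split.
Qed.

Lemma block_color_proper p B B' : B \in blocks -> B' \in blocks ->
  p \in B -> p \in B' -> B != B' -> block_color p B = block_color p B' ->
  forall q, q \in B -> q \in B' -> q = p.
Proof.
move=> BH BH' pB pB'; have [/allP pr _] := colors_okP p.
have [s -> [sz _]] := block_colorP BH pB; have [s' -> [sz' _]] := block_colorP BH' pB'.
move=> nB E q; rewrite !in_points => qs qs'; apply/code_inj/eqP.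
have := allP (pr _ sz) _ sz'; rewrite /= E eqxx /= => /orP[/eqP Es|/allP/(_ _ qs)].
  by rewrite Es eqxx in nB.
by rewrite qs'.
Qed.

Lemma block_color_lt8 p B : B \in blocks -> p \in B -> mode p.1 = None ->
  block_color p B < 8.
Proof.
move=> BH pB M; have [_] := colors_okP p; rewrite M => /allP; apply.
by have [s _ []] := block_colorP BH pB.
Qed.

Lemma block_color_special p B o : B \in blocks -> p \in B -> mode p.1 = Some o ->
  [/\ block_color p B < 10,
      forall q, q \in B -> q != p -> q.1 != block_color p B :> nat &
      forall q, q \in B -> q != p -> block_color p B = p.1 -> q.1 != o :> nat].
Proof.
move=> BH pB M; have [_] := colors_okP p; rewrite M => /allP sp.
have [s -> [/sp /andP[c10 /allP h] _]] := block_colorP BH pB.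
have key q : code q \in s -> q != p -> (q.1 != block_color p (points s) :> nat) &&
    ((block_color p (points s) == p.1) ==> (q.1 != o :> nat)).
  by move=> /h; rewrite (inj_eq code_inj) !code_half => /orP[->|].
split=> // q; rewrite in_points => qs qp; first by case/andP: (key q qs qp).
by move=> E; case/andP: (key q qs qp) => _; rewrite E eqxx.
Qed.

End Table.

(* The tables come from computer searches: the first system is invariant under
   a cyclic group of order 20, the other two under groups of order 8 and 6. *)
Definition blocks0 : seq (seq nat) := [::
[:: 0; 2; 4; 12]; [:: 0; 2; 5; 13]; [:: 0; 2; 6; 8]; [:: 0; 2; 7; 9];
[:: 0; 2; 10; 19]; [:: 0; 2; 11; 18]; [:: 0; 2; 14; 16]; [:: 0; 2; 15; 17];
[:: 0; 3; 4; 13]; [:: 0; 3; 5; 12]; [:: 0; 3; 6; 9]; [:: 0; 3; 7; 8];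
[:: 0; 3; 10; 18]; [:: 0; 3; 11; 19]; [:: 0; 3; 14; 17]; [:: 0; 3; 15; 16];
[:: 0; 4; 6; 19]; [:: 0; 4; 7; 18]; [:: 0; 4; 8; 14]; [:: 0; 4; 9; 15];
[:: 0; 4; 10; 17]; [:: 0; 4; 11; 16]; [:: 0; 5; 6; 18]; [:: 0; 5; 7; 19];
[:: 0; 5; 8; 15]; [:: 0; 5; 9; 14]; [:: 0; 5; 10; 16]; [:: 0; 5; 11; 17];
[:: 0; 6; 10; 15]; [:: 0; 6; 11; 14]; [:: 0; 6; 12; 16]; [:: 0; 6; 13; 17];
[:: 0; 7; 10; 14]; [:: 0; 7; 11; 15]; [:: 0; 7; 12; 17]; [:: 0; 7; 13; 16];
[:: 0; 8; 10; 13]; [:: 0; 8; 11; 12]; [:: 0; 8; 16; 18]; [:: 0; 8; 17; 19];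
[:: 0; 9; 10; 12]; [:: 0; 9; 11; 13]; [:: 0; 9; 16; 19]; [:: 0; 9; 17; 18];
[:: 0; 12; 14; 19]; [:: 0; 12; 15; 18]; [:: 0; 13; 14; 18]; [:: 0; 13; 15; 19];
[:: 1; 2; 4; 13]; [:: 1; 2; 5; 12]; [:: 1; 2; 6; 9]; [:: 1; 2; 7; 8];
[:: 1; 2; 10; 18]; [:: 1; 2; 11; 19]; [:: 1; 2; 14; 17]; [:: 1; 2; 15; 16];
[:: 1; 3; 4; 12]; [:: 1; 3; 5; 13]; [:: 1; 3; 6; 8]; [:: 1; 3; 7; 9];
[:: 1; 3; 10; 19]; [:: 1; 3; 11; 18]; [:: 1; 3; 14; 16]; [:: 1; 3; 15; 17];
[:: 1; 4; 6; 18]; [:: 1; 4; 7; 19]; [:: 1; 4; 8; 15]; [:: 1; 4; 9; 14];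
[:: 1; 4; 10; 16]; [:: 1; 4; 11; 17]; [:: 1; 5; 6; 19]; [:: 1; 5; 7; 18];
[:: 1; 5; 8; 14]; [:: 1; 5; 9; 15]; [:: 1; 5; 10; 17]; [:: 1; 5; 11; 16];
[:: 1; 6; 10; 14]; [:: 1; 6; 11; 15]; [:: 1; 6; 12; 17]; [:: 1; 6; 13; 16];
[:: 1; 7; 10; 15]; [:: 1; 7; 11; 14]; [:: 1; 7; 12; 16]; [:: 1; 7; 13; 17];
[:: 1; 8; 10; 12]; [:: 1; 8; 11; 13]; [:: 1; 8; 16; 19]; [:: 1; 8; 17; 18];
[:: 1; 9; 10; 13]; [:: 1; 9; 11; 12]; [:: 1; 9; 16; 18]; [:: 1; 9; 17; 19];
[:: 1; 12; 14; 18]; [:: 1; 12; 15; 19]; [:: 1; 13; 14; 19]; [:: 1; 13; 15; 18];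
[:: 2; 4; 6; 14]; [:: 2; 4; 7; 15]; [:: 2; 4; 8; 10]; [:: 2; 4; 9; 11];
[:: 2; 4; 16; 18]; [:: 2; 4; 17; 19]; [:: 2; 5; 6; 15]; [:: 2; 5; 7; 14];
[:: 2; 5; 8; 11]; [:: 2; 5; 9; 10]; [:: 2; 5; 16; 19]; [:: 2; 5; 17; 18];
[:: 2; 6; 10; 16]; [:: 2; 6; 11; 17]; [:: 2; 6; 12; 19]; [:: 2; 6; 13; 18];
[:: 2; 7; 10; 17]; [:: 2; 7; 11; 16]; [:: 2; 7; 12; 18]; [:: 2; 7; 13; 19];
[:: 2; 8; 12; 17]; [:: 2; 8; 13; 16]; [:: 2; 8; 14; 18]; [:: 2; 8; 15; 19];
[:: 2; 9; 12; 16]; [:: 2; 9; 13; 17]; [:: 2; 9; 14; 19]; [:: 2; 9; 15; 18];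
[:: 2; 10; 12; 15]; [:: 2; 10; 13; 14]; [:: 2; 11; 12; 14]; [:: 2; 11; 13; 15];
[:: 3; 4; 6; 15]; [:: 3; 4; 7; 14]; [:: 3; 4; 8; 11]; [:: 3; 4; 9; 10];
[:: 3; 4; 16; 19]; [:: 3; 4; 17; 18]; [:: 3; 5; 6; 14]; [:: 3; 5; 7; 15];
[:: 3; 5; 8; 10]; [:: 3; 5; 9; 11]; [:: 3; 5; 16; 18]; [:: 3; 5; 17; 19];
[:: 3; 6; 10; 17]; [:: 3; 6; 11; 16]; [:: 3; 6; 12; 18]; [:: 3; 6; 13; 19];
[:: 3; 7; 10; 16]; [:: 3; 7; 11; 17]; [:: 3; 7; 12; 19]; [:: 3; 7; 13; 18];
[:: 3; 8; 12; 16]; [:: 3; 8; 13; 17]; [:: 3; 8; 14; 19]; [:: 3; 8; 15; 18];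
[:: 3; 9; 12; 17]; [:: 3; 9; 13; 16]; [:: 3; 9; 14; 18]; [:: 3; 9; 15; 19];
[:: 3; 10; 12; 14]; [:: 3; 10; 13; 15]; [:: 3; 11; 12; 15]; [:: 3; 11; 13; 14];
[:: 4; 6; 8; 16]; [:: 4; 6; 9; 17]; [:: 4; 6; 10; 12]; [:: 4; 6; 11; 13];
[:: 4; 7; 8; 17]; [:: 4; 7; 9; 16]; [:: 4; 7; 10; 13]; [:: 4; 7; 11; 12];
[:: 4; 8; 12; 18]; [:: 4; 8; 13; 19]; [:: 4; 9; 12; 19]; [:: 4; 9; 13; 18];
[:: 4; 10; 14; 19]; [:: 4; 10; 15; 18]; [:: 4; 11; 14; 18]; [:: 4; 11; 15; 19];
[:: 4; 12; 14; 17]; [:: 4; 12; 15; 16]; [:: 4; 13; 14; 16]; [:: 4; 13; 15; 17];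
[:: 5; 6; 8; 17]; [:: 5; 6; 9; 16]; [:: 5; 6; 10; 13]; [:: 5; 6; 11; 12];
[:: 5; 7; 8; 16]; [:: 5; 7; 9; 17]; [:: 5; 7; 10; 12]; [:: 5; 7; 11; 13];
[:: 5; 8; 12; 19]; [:: 5; 8; 13; 18]; [:: 5; 9; 12; 18]; [:: 5; 9; 13; 19];
[:: 5; 10; 14; 18]; [:: 5; 10; 15; 19]; [:: 5; 11; 14; 19]; [:: 5; 11; 15; 18];
[:: 5; 12; 14; 16]; [:: 5; 12; 15; 17]; [:: 5; 13; 14; 17]; [:: 5; 13; 15; 16];
[:: 6; 8; 10; 18]; [:: 6; 8; 11; 19]; [:: 6; 8; 12; 14]; [:: 6; 8; 13; 15];
[:: 6; 9; 10; 19]; [:: 6; 9; 11; 18]; [:: 6; 9; 12; 15]; [:: 6; 9; 13; 14];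
[:: 6; 14; 16; 19]; [:: 6; 14; 17; 18]; [:: 6; 15; 16; 18]; [:: 6; 15; 17; 19];
[:: 7; 8; 10; 19]; [:: 7; 8; 11; 18]; [:: 7; 8; 12; 15]; [:: 7; 8; 13; 14];
[:: 7; 9; 10; 18]; [:: 7; 9; 11; 19]; [:: 7; 9; 12; 14]; [:: 7; 9; 13; 15];
[:: 7; 14; 16; 18]; [:: 7; 14; 17; 19]; [:: 7; 15; 16; 19]; [:: 7; 15; 17; 18];
[:: 8; 10; 14; 16]; [:: 8; 10; 15; 17]; [:: 8; 11; 14; 17]; [:: 8; 11; 15; 16];
[:: 9; 10; 14; 17]; [:: 9; 10; 15; 16]; [:: 9; 11; 14; 16]; [:: 9; 11; 15; 17];
[:: 10; 12; 16; 18]; [:: 10; 12; 17; 19]; [:: 10; 13; 16; 19]; [:: 10; 13; 17; 18];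
[:: 11; 12; 16; 19]; [:: 11; 12; 17; 18]; [:: 11; 13; 16; 18]; [:: 11; 13; 17; 19]].

Definition colors0 : seq (seq nat) := [::
[:: 7; 4; 0; 1; 2; 3; 6; 5; 6; 5; 2; 3; 0; 1; 7; 4; 4; 5; 2; 3; 1; 0; 6; 7; 1; 0; 3; 2; 7; 5; 1; 3; 4; 6; 0; 2; 5; 4; 7; 6; 6; 7; 5; 4; 3; 2; 1; 0];
[:: 7; 4; 0; 1; 3; 2; 5; 6; 5; 6; 2; 3; 0; 1; 4; 7; 6; 4; 3; 1; 2; 0; 5; 7; 0; 2; 1; 3; 7; 4; 3; 1; 5; 6; 0; 2; 6; 5; 7; 4; 4; 7; 5; 6; 2; 1; 3; 0];
[:: 5; 6; 0; 2; 1; 3; 4; 7; 4; 7; 3; 1; 0; 2; 6; 5; 2; 3; 6; 7; 1; 0; 1; 0; 5; 4; 3; 2; 7; 4; 6; 5; 5; 6; 4; 7; 3; 2; 7; 4; 0; 1; 5; 6; 2; 3; 1; 0];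
[:: 4; 6; 0; 1; 2; 3; 5; 7; 7; 5; 3; 2; 0; 1; 4; 6; 1; 3; 5; 6; 2; 0; 2; 0; 7; 4; 3; 1; 4; 6; 5; 7; 5; 7; 4; 6; 0; 2; 6; 4; 3; 1; 7; 5; 1; 3; 2; 0];
[:: 5; 4; 3; 1; 6; 7; 2; 0; 6; 7; 2; 0; 4; 5; 3; 1; 0; 3; 1; 2; 4; 7; 1; 2; 3; 0; 5; 6; 7; 4; 6; 5; 5; 6; 7; 4; 0; 2; 1; 3; 4; 5; 7; 6; 3; 2; 1; 0];
[:: 1; 2; 3; 0; 4; 6; 7; 5; 0; 3; 2; 1; 7; 5; 6; 4; 7; 5; 3; 2; 6; 4; 4; 6; 1; 0; 5; 7; 0; 1; 5; 6; 2; 3; 4; 7; 5; 6; 7; 4; 0; 3; 1; 2; 3; 1; 2; 0];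
[:: 3; 0; 5; 4; 6; 7; 2; 1; 1; 2; 7; 6; 4; 5; 3; 0; 0; 2; 7; 6; 4; 5; 3; 1; 5; 4; 6; 7; 6; 4; 1; 2; 7; 5; 3; 0; 0; 1; 5; 4; 2; 3; 7; 6; 3; 2; 1; 0];
[:: 3; 0; 4; 5; 6; 7; 1; 2; 1; 2; 6; 7; 4; 5; 0; 3; 2; 0; 5; 4; 6; 7; 1; 3; 7; 6; 4; 5; 7; 5; 0; 3; 6; 4; 2; 1; 3; 2; 5; 4; 1; 0; 7; 6; 3; 2; 1; 0];
[:: 4; 0; 5; 1; 2; 3; 6; 7; 3; 1; 7; 6; 0; 4; 5; 2; 6; 7; 5; 1; 0; 2; 2; 5; 7; 6; 3; 4; 3; 4; 1; 0; 0; 2; 4; 3; 7; 6; 2; 5; 1; 5; 6; 7; 4; 3; 1; 0];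
[:: 3; 0; 7; 6; 1; 2; 4; 5; 2; 1; 5; 4; 0; 3; 6; 7; 4; 7; 5; 6; 0; 1; 6; 5; 4; 7; 2; 3; 1; 0; 2; 3; 3; 2; 0; 1; 5; 7; 6; 4; 4; 6; 7; 5; 3; 2; 1; 0];
[:: 7; 6; 3; 0; 1; 2; 4; 5; 5; 4; 1; 2; 0; 3; 6; 7; 2; 3; 6; 4; 0; 1; 0; 1; 7; 5; 3; 2; 4; 6; 5; 7; 5; 7; 4; 6; 3; 2; 0; 1; 7; 5; 6; 4; 2; 1; 3; 0];
[:: 7; 4; 0; 1; 2; 3; 5; 6; 6; 5; 2; 3; 1; 0; 4; 7; 3; 0; 5; 4; 1; 2; 1; 2; 6; 7; 0; 3; 7; 6; 4; 5; 4; 5; 7; 6; 3; 0; 2; 1; 6; 7; 5; 4; 2; 3; 1; 0];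
[:: 2; 0; 5; 7; 1; 3; 4; 6; 1; 3; 4; 6; 0; 2; 7; 5; 0; 3; 6; 7; 4; 5; 2; 1; 4; 5; 6; 7; 7; 4; 5; 6; 1; 0; 6; 5; 7; 4; 2; 3; 3; 1; 2; 0; 1; 2; 3; 0];
[:: 1; 0; 7; 6; 3; 2; 5; 4; 3; 2; 5; 4; 1; 0; 6; 7; 0; 2; 4; 6; 7; 5; 3; 1; 5; 7; 6; 4; 6; 5; 7; 4; 2; 1; 4; 7; 6; 5; 3; 0; 2; 1; 0; 3; 1; 2; 3; 0];
[:: 7; 6; 2; 5; 3; 1; 0; 4; 3; 5; 6; 7; 0; 4; 2; 1; 1; 2; 0; 4; 6; 5; 0; 4; 3; 1; 7; 2; 5; 7; 4; 3; 3; 6; 1; 0; 6; 7; 2; 5; 5; 3; 6; 7; 4; 1; 2; 0];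
[:: 6; 4; 3; 0; 7; 5; 2; 1; 7; 5; 1; 2; 6; 4; 0; 3; 0; 1; 5; 4; 3; 2; 2; 3; 6; 7; 0; 1; 5; 4; 6; 7; 6; 7; 4; 5; 4; 5; 0; 3; 7; 6; 2; 1; 2; 3; 1; 0];
[:: 2; 3; 4; 5; 6; 7; 1; 0; 0; 1; 6; 7; 5; 4; 2; 3; 7; 4; 3; 1; 6; 5; 5; 6; 2; 0; 7; 4; 0; 2; 1; 3; 1; 3; 0; 2; 7; 4; 5; 6; 4; 5; 7; 6; 2; 1; 3; 0];
[:: 3; 1; 0; 4; 2; 6; 7; 5; 4; 0; 2; 1; 7; 5; 6; 3; 5; 2; 6; 7; 0; 1; 7; 6; 5; 3; 4; 2; 4; 1; 3; 6; 3; 0; 5; 7; 0; 1; 2; 4; 2; 5; 6; 7; 4; 3; 1; 0];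
[:: 7; 4; 0; 1; 3; 2; 5; 6; 5; 6; 2; 3; 0; 1; 4; 7; 6; 4; 3; 1; 2; 0; 5; 7; 0; 2; 1; 3; 7; 4; 3; 1; 5; 6; 0; 2; 6; 5; 7; 4; 4; 7; 5; 6; 2; 1; 3; 0];
[:: 7; 4; 0; 1; 2; 3; 6; 5; 6; 5; 2; 3; 0; 1; 7; 4; 4; 5; 2; 3; 1; 0; 6; 7; 1; 0; 3; 2; 7; 5; 1; 3; 4; 6; 0; 2; 5; 4; 7; 6; 6; 7; 5; 4; 3; 2; 1; 0]].

Definition blocks1 : seq (seq nat) := [::
[:: 0; 2; 4; 6]; [:: 0; 2; 5; 7]; [:: 0; 2; 8; 14]; [:: 0; 2; 9; 15];
[:: 0; 2; 10; 13]; [:: 0; 2; 11; 12]; [:: 0; 2; 16; 19]; [:: 0; 2; 17; 18];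
[:: 0; 3; 4; 15]; [:: 0; 3; 5; 14]; [:: 0; 3; 6; 9]; [:: 0; 3; 7; 8];
[:: 0; 3; 10; 18]; [:: 0; 3; 11; 19]; [:: 0; 3; 12; 16]; [:: 0; 3; 13; 17];
[:: 0; 4; 7; 19]; [:: 0; 4; 8; 10]; [:: 0; 4; 9; 17]; [:: 0; 4; 11; 18];
[:: 0; 4; 12; 14]; [:: 0; 4; 13; 16]; [:: 0; 5; 6; 11]; [:: 0; 5; 8; 17];
[:: 0; 5; 9; 10]; [:: 0; 5; 12; 18]; [:: 0; 5; 13; 19]; [:: 0; 5; 15; 16];
[:: 0; 6; 8; 16]; [:: 0; 6; 10; 19]; [:: 0; 6; 12; 17]; [:: 0; 6; 13; 15];
[:: 0; 6; 14; 18]; [:: 0; 7; 9; 12]; [:: 0; 7; 10; 16]; [:: 0; 7; 11; 17];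
[:: 0; 7; 13; 14]; [:: 0; 7; 15; 18]; [:: 0; 8; 11; 15]; [:: 0; 8; 12; 19];
[:: 0; 8; 13; 18]; [:: 0; 9; 11; 13]; [:: 0; 9; 14; 19]; [:: 0; 9; 16; 18];
[:: 0; 10; 12; 15]; [:: 0; 10; 14; 17]; [:: 0; 11; 14; 16]; [:: 0; 15; 17; 19];
[:: 1; 2; 4; 15]; [:: 1; 2; 5; 14]; [:: 1; 2; 6; 9]; [:: 1; 2; 7; 8];
[:: 1; 2; 10; 18]; [:: 1; 2; 11; 19]; [:: 1; 2; 12; 16]; [:: 1; 2; 13; 17];
[:: 1; 3; 4; 6]; [:: 1; 3; 5; 7]; [:: 1; 3; 8; 14]; [:: 1; 3; 9; 15];
[:: 1; 3; 10; 13]; [:: 1; 3; 11; 12]; [:: 1; 3; 16; 19]; [:: 1; 3; 17; 18];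
[:: 1; 4; 7; 10]; [:: 1; 4; 8; 11]; [:: 1; 4; 9; 16]; [:: 1; 4; 12; 18];
[:: 1; 4; 13; 19]; [:: 1; 4; 14; 17]; [:: 1; 5; 6; 18]; [:: 1; 5; 8; 16];
[:: 1; 5; 9; 11]; [:: 1; 5; 10; 19]; [:: 1; 5; 12; 17]; [:: 1; 5; 13; 15];
[:: 1; 6; 8; 13]; [:: 1; 6; 10; 16]; [:: 1; 6; 11; 17]; [:: 1; 6; 12; 15];
[:: 1; 6; 14; 19]; [:: 1; 7; 9; 17]; [:: 1; 7; 11; 18]; [:: 1; 7; 12; 14];
[:: 1; 7; 13; 16]; [:: 1; 7; 15; 19]; [:: 1; 8; 10; 12]; [:: 1; 8; 15; 18];
[:: 1; 8; 17; 19]; [:: 1; 9; 10; 14]; [:: 1; 9; 12; 19]; [:: 1; 9; 13; 18];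
[:: 1; 10; 15; 17]; [:: 1; 11; 13; 14]; [:: 1; 11; 15; 16]; [:: 1; 14; 16; 18];
[:: 2; 4; 7; 12]; [:: 2; 4; 8; 17]; [:: 2; 4; 9; 19]; [:: 2; 4; 10; 14];
[:: 2; 4; 11; 13]; [:: 2; 4; 16; 18]; [:: 2; 5; 6; 16]; [:: 2; 5; 8; 11];
[:: 2; 5; 9; 13]; [:: 2; 5; 10; 17]; [:: 2; 5; 12; 19]; [:: 2; 5; 15; 18];
[:: 2; 6; 8; 18]; [:: 2; 6; 10; 12]; [:: 2; 6; 11; 15]; [:: 2; 6; 13; 14];
[:: 2; 6; 17; 19]; [:: 2; 7; 9; 10]; [:: 2; 7; 11; 16]; [:: 2; 7; 13; 18];
[:: 2; 7; 14; 19]; [:: 2; 7; 15; 17]; [:: 2; 8; 10; 19]; [:: 2; 8; 12; 15];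
[:: 2; 8; 13; 16]; [:: 2; 9; 11; 17]; [:: 2; 9; 12; 18]; [:: 2; 9; 14; 16];
[:: 2; 10; 15; 16]; [:: 2; 11; 14; 18]; [:: 2; 12; 14; 17]; [:: 2; 13; 15; 19];
[:: 3; 4; 7; 17]; [:: 3; 4; 8; 12]; [:: 3; 4; 9; 10]; [:: 3; 4; 11; 16];
[:: 3; 4; 13; 18]; [:: 3; 4; 14; 19]; [:: 3; 5; 6; 13]; [:: 3; 5; 8; 18];
[:: 3; 5; 9; 16]; [:: 3; 5; 10; 12]; [:: 3; 5; 11; 15]; [:: 3; 5; 17; 19];
[:: 3; 6; 8; 11]; [:: 3; 6; 10; 17]; [:: 3; 6; 12; 19]; [:: 3; 6; 14; 16];
[:: 3; 6; 15; 18]; [:: 3; 7; 9; 19]; [:: 3; 7; 10; 14]; [:: 3; 7; 11; 13];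
[:: 3; 7; 12; 15]; [:: 3; 7; 16; 18]; [:: 3; 8; 10; 16]; [:: 3; 8; 13; 19];
[:: 3; 8; 15; 17]; [:: 3; 9; 11; 18]; [:: 3; 9; 12; 17]; [:: 3; 9; 13; 14];
[:: 3; 10; 15; 19]; [:: 3; 11; 14; 17]; [:: 3; 12; 14; 18]; [:: 3; 13; 15; 16];
[:: 4; 6; 8; 19]; [:: 4; 6; 9; 15]; [:: 4; 6; 10; 13]; [:: 4; 6; 11; 14];
[:: 4; 6; 12; 16]; [:: 4; 6; 17; 18]; [:: 4; 7; 8; 18]; [:: 4; 7; 9; 13];
[:: 4; 7; 11; 15]; [:: 4; 7; 14; 16]; [:: 4; 8; 13; 14]; [:: 4; 8; 15; 16];
[:: 4; 9; 11; 12]; [:: 4; 9; 14; 18]; [:: 4; 10; 12; 17]; [:: 4; 10; 15; 18];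
[:: 4; 10; 16; 19]; [:: 4; 11; 17; 19]; [:: 4; 12; 15; 19]; [:: 4; 13; 15; 17];
[:: 5; 6; 8; 12]; [:: 5; 6; 9; 19]; [:: 5; 6; 10; 14]; [:: 5; 6; 15; 17];
[:: 5; 7; 8; 14]; [:: 5; 7; 9; 18]; [:: 5; 7; 10; 15]; [:: 5; 7; 11; 12];
[:: 5; 7; 13; 17]; [:: 5; 7; 16; 19]; [:: 5; 8; 10; 13]; [:: 5; 8; 15; 19];
[:: 5; 9; 12; 15]; [:: 5; 9; 14; 17]; [:: 5; 10; 16; 18]; [:: 5; 11; 13; 16];
[:: 5; 11; 14; 19]; [:: 5; 11; 17; 18]; [:: 5; 12; 14; 16]; [:: 5; 13; 14; 18];
[:: 6; 8; 10; 15]; [:: 6; 8; 14; 17]; [:: 6; 9; 10; 18]; [:: 6; 9; 11; 16];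
[:: 6; 9; 12; 14]; [:: 6; 9; 13; 17]; [:: 6; 11; 12; 18]; [:: 6; 11; 13; 19];
[:: 6; 13; 16; 18]; [:: 6; 15; 16; 19]; [:: 7; 8; 10; 17]; [:: 7; 8; 11; 19];
[:: 7; 8; 12; 16]; [:: 7; 8; 13; 15]; [:: 7; 9; 11; 14]; [:: 7; 9; 15; 16];
[:: 7; 10; 12; 18]; [:: 7; 10; 13; 19]; [:: 7; 12; 17; 19]; [:: 7; 14; 17; 18];
[:: 8; 10; 14; 18]; [:: 8; 11; 12; 14]; [:: 8; 11; 13; 17]; [:: 8; 11; 16; 18];
[:: 8; 12; 17; 18]; [:: 8; 14; 16; 19]; [:: 9; 10; 12; 16]; [:: 9; 10; 13; 15];
[:: 9; 10; 17; 19]; [:: 9; 11; 15; 19]; [:: 9; 13; 16; 19]; [:: 9; 15; 17; 18];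
[:: 10; 12; 14; 19]; [:: 10; 13; 14; 16]; [:: 10; 13; 17; 18]; [:: 11; 12; 15; 17];
[:: 11; 12; 16; 19]; [:: 11; 13; 15; 18]; [:: 12; 15; 16; 18]; [:: 13; 14; 17; 19]].

Definition colors1 : seq (seq nat) := [::
[:: 5; 0; 6; 7; 4; 3; 2; 1; 4; 2; 1; 3; 0; 5; 7; 6; 6; 2; 0; 7; 1; 3; 6; 7; 3; 4; 1; 5; 4; 7; 2; 0; 3; 5; 1; 4; 7; 2; 1; 0; 5; 2; 4; 6; 6; 5; 0; 3];
[:: 1; 3; 2; 4; 5; 0; 6; 7; 0; 5; 7; 6; 2; 3; 4; 1; 6; 2; 7; 4; 3; 5; 6; 0; 1; 7; 2; 4; 5; 3; 4; 7; 1; 3; 7; 0; 1; 2; 1; 3; 6; 4; 5; 0; 0; 6; 5; 2];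
[:: 7; 9; 6; 5; 3; 8; 2; 4; 8; 4; 9; 5; 6; 3; 7; 2; 1; 3; 6; 0; 9; 5; 6; 0; 8; 1; 5; 3; 8; 4; 1; 5; 0; 2; 4; 7; 8; 6; 7; 2; 1; 7; 0; 3; 9; 2; 9; 4];
[:: 4; 5; 9; 6; 3; 8; 2; 7; 5; 7; 9; 8; 2; 3; 4; 6; 9; 8; 6; 0; 1; 3; 8; 0; 3; 9; 6; 1; 1; 4; 7; 6; 2; 2; 8; 4; 1; 5; 7; 5; 3; 7; 5; 0; 0; 2; 4; 9];
[:: 8; 3; 1; 9; 7; 6; 4; 5; 6; 7; 4; 3; 9; 5; 8; 1; 9; 5; 0; 2; 7; 3; 0; 8; 6; 2; 4; 5; 6; 5; 1; 9; 0; 2; 7; 2; 8; 6; 0; 1; 1; 8; 3; 0; 7; 4; 2; 9];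
[:: 7; 6; 4; 9; 3; 8; 5; 1; 3; 8; 1; 7; 9; 6; 5; 4; 2; 6; 8; 0; 4; 5; 9; 2; 5; 7; 0; 3; 0; 7; 8; 6; 5; 6; 9; 1; 2; 0; 1; 8; 2; 1; 4; 3; 2; 7; 9; 0];
[:: 4; 6; 9; 1; 8; 7; 2; 5; 8; 7; 4; 9; 2; 6; 5; 1; 5; 6; 9; 0; 3; 2; 0; 2; 4; 3; 9; 8; 5; 9; 1; 8; 0; 3; 8; 7; 6; 1; 3; 0; 0; 3; 2; 5; 1; 4; 7; 6];
[:: 4; 8; 7; 1; 6; 9; 5; 2; 2; 6; 1; 7; 8; 4; 9; 5; 3; 9; 7; 0; 8; 6; 5; 0; 3; 2; 9; 4; 6; 8; 4; 0; 9; 5; 8; 0; 3; 1; 0; 3; 5; 1; 6; 3; 7; 4; 2; 1];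
[:: 5; 2; 8; 6; 7; 9; 3; 1; 6; 9; 1; 5; 8; 2; 3; 7; 4; 3; 2; 0; 8; 9; 7; 8; 6; 3; 4; 0; 5; 0; 3; 6; 9; 4; 7; 1; 4; 1; 9; 8; 1; 5; 6; 0; 2; 4; 5; 2];
[:: 2; 7; 9; 3; 5; 1; 8; 6; 8; 9; 5; 7; 2; 6; 1; 3; 0; 9; 4; 6; 7; 3; 8; 4; 6; 2; 0; 5; 6; 7; 3; 4; 5; 0; 8; 1; 1; 0; 2; 4; 9; 1; 9; 0; 7; 4; 2; 5];
[:: 4; 8; 9; 7; 6; 1; 3; 2; 6; 7; 4; 3; 2; 1; 8; 9; 3; 0; 7; 9; 2; 5; 6; 9; 4; 5; 3; 0; 0; 5; 1; 7; 1; 6; 5; 4; 8; 5; 7; 2; 8; 0; 0; 2; 1; 4; 9; 3];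
[:: 7; 6; 3; 4; 2; 8; 1; 9; 8; 4; 7; 9; 1; 6; 3; 2; 9; 6; 0; 4; 3; 5; 5; 3; 9; 7; 2; 0; 6; 1; 0; 4; 5; 0; 1; 7; 7; 8; 2; 0; 8; 2; 5; 1; 5; 9; 3; 4];
[:: 8; 9; 1; 5; 4; 7; 3; 2; 3; 4; 8; 7; 1; 5; 9; 2; 9; 4; 7; 6; 0; 2; 7; 0; 6; 8; 5; 3; 0; 6; 3; 5; 8; 1; 3; 6; 9; 2; 2; 6; 0; 0; 1; 1; 8; 9; 7; 4];
[:: 4; 3; 7; 8; 5; 1; 2; 9; 9; 8; 5; 1; 7; 4; 3; 2; 0; 7; 8; 6; 5; 3; 4; 9; 7; 0; 6; 2; 1; 8; 3; 6; 0; 6; 3; 5; 2; 6; 0; 9; 2; 1; 0; 1; 9; 7; 8; 4];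
[:: 5; 6; 3; 4; 9; 8; 1; 2; 4; 3; 9; 2; 5; 6; 8; 1; 8; 0; 6; 9; 3; 7; 0; 5; 7; 2; 4; 8; 7; 4; 1; 5; 9; 8; 3; 1; 0; 7; 6; 1; 0; 2; 0; 9; 7; 4; 3; 5];
[:: 8; 9; 4; 2; 5; 1; 3; 6; 3; 5; 9; 8; 1; 2; 4; 6; 6; 7; 0; 5; 2; 4; 8; 4; 2; 7; 0; 3; 6; 4; 0; 8; 7; 5; 1; 7; 3; 0; 9; 5; 8; 9; 1; 2; 3; 9; 0; 1];
[:: 6; 5; 7; 4; 1; 9; 3; 2; 2; 7; 1; 9; 6; 4; 3; 5; 4; 5; 7; 3; 0; 8; 0; 6; 4; 8; 2; 9; 8; 6; 5; 3; 1; 0; 8; 3; 9; 2; 0; 0; 2; 6; 8; 7; 5; 1; 4; 1];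
[:: 7; 2; 9; 1; 4; 6; 3; 5; 5; 6; 4; 7; 9; 1; 3; 2; 6; 8; 0; 4; 2; 9; 5; 4; 7; 8; 3; 0; 1; 0; 8; 3; 6; 0; 5; 3; 2; 8; 9; 2; 8; 7; 5; 6; 0; 4; 1; 1];
[:: 7; 6; 8; 1; 5; 4; 3; 2; 8; 4; 3; 7; 2; 6; 5; 1; 4; 5; 2; 9; 0; 3; 7; 0; 8; 5; 9; 2; 9; 1; 6; 0; 8; 3; 6; 4; 1; 4; 0; 7; 0; 9; 7; 5; 3; 2; 1; 9];
[:: 5; 4; 7; 8; 6; 3; 2; 1; 2; 3; 1; 7; 8; 4; 6; 5; 0; 4; 7; 9; 8; 3; 6; 5; 9; 8; 7; 0; 5; 4; 9; 8; 1; 6; 9; 3; 0; 2; 1; 2; 0; 0; 3; 6; 9; 1; 7; 4]].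

Definition blocks2 : seq (seq nat) := [::
[:: 0; 2; 4; 7]; [:: 0; 2; 5; 6]; [:: 0; 2; 8; 13]; [:: 0; 2; 9; 14];
[:: 0; 2; 10; 18]; [:: 0; 2; 11; 19]; [:: 0; 2; 12; 17]; [:: 0; 2; 15; 16];
[:: 0; 3; 4; 6]; [:: 0; 3; 5; 7]; [:: 0; 3; 8; 17]; [:: 0; 3; 9; 16];
[:: 0; 3; 10; 13]; [:: 0; 3; 11; 15]; [:: 0; 3; 12; 19]; [:: 0; 3; 14; 18];
[:: 0; 4; 8; 19]; [:: 0; 4; 9; 10]; [:: 0; 4; 11; 16]; [:: 0; 4; 12; 14];
[:: 0; 4; 13; 15]; [:: 0; 4; 17; 18]; [:: 0; 5; 8; 15]; [:: 0; 5; 9; 12];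
[:: 0; 5; 10; 19]; [:: 0; 5; 11; 18]; [:: 0; 5; 13; 17]; [:: 0; 5; 14; 16];
[:: 0; 6; 8; 16]; [:: 0; 6; 9; 17]; [:: 0; 6; 10; 15]; [:: 0; 6; 11; 12];
[:: 0; 6; 13; 18]; [:: 0; 6; 14; 19]; [:: 0; 7; 8; 11]; [:: 0; 7; 9; 19];
[:: 0; 7; 10; 17]; [:: 0; 7; 12; 15]; [:: 0; 7; 13; 14]; [:: 0; 7; 16; 18];
[:: 0; 8; 10; 14]; [:: 0; 8; 12; 18]; [:: 0; 9; 11; 13]; [:: 0; 9; 15; 18];
[:: 0; 10; 12; 16]; [:: 0; 11; 14; 17]; [:: 0; 13; 16; 19]; [:: 0; 15; 17; 19];
[:: 1; 2; 4; 6]; [:: 1; 2; 5; 7]; [:: 1; 2; 8; 17]; [:: 1; 2; 9; 16];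
[:: 1; 2; 10; 14]; [:: 1; 2; 11; 12]; [:: 1; 2; 13; 18]; [:: 1; 2; 15; 19];
[:: 1; 3; 4; 7]; [:: 1; 3; 5; 6]; [:: 1; 3; 8; 15]; [:: 1; 3; 9; 12];
[:: 1; 3; 10; 18]; [:: 1; 3; 11; 19]; [:: 1; 3; 13; 16]; [:: 1; 3; 14; 17];
[:: 1; 4; 8; 13]; [:: 1; 4; 9; 14]; [:: 1; 4; 10; 19]; [:: 1; 4; 11; 18];
[:: 1; 4; 12; 16]; [:: 1; 4; 15; 17]; [:: 1; 5; 8; 11]; [:: 1; 5; 9; 18];
[:: 1; 5; 10; 17]; [:: 1; 5; 12; 14]; [:: 1; 5; 13; 15]; [:: 1; 5; 16; 19];
[:: 1; 6; 8; 18]; [:: 1; 6; 9; 10]; [:: 1; 6; 11; 16]; [:: 1; 6; 12; 15];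
[:: 1; 6; 13; 14]; [:: 1; 6; 17; 19]; [:: 1; 7; 8; 16]; [:: 1; 7; 9; 17];
[:: 1; 7; 10; 13]; [:: 1; 7; 11; 14]; [:: 1; 7; 12; 19]; [:: 1; 7; 15; 18];
[:: 1; 8; 10; 12]; [:: 1; 8; 14; 19]; [:: 1; 9; 11; 15]; [:: 1; 9; 13; 19];
[:: 1; 10; 15; 16]; [:: 1; 11; 13; 17]; [:: 1; 12; 17; 18]; [:: 1; 14; 16; 18];
[:: 2; 4; 8; 10]; [:: 2; 4; 9; 19]; [:: 2; 4; 11; 17]; [:: 2; 4; 12; 15];
[:: 2; 4; 13; 14]; [:: 2; 4; 16; 18]; [:: 2; 5; 8; 16]; [:: 2; 5; 9; 17];
[:: 2; 5; 10; 12]; [:: 2; 5; 11; 14]; [:: 2; 5; 13; 19]; [:: 2; 5; 15; 18];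
[:: 2; 6; 8; 12]; [:: 2; 6; 9; 15]; [:: 2; 6; 10; 19]; [:: 2; 6; 11; 18];
[:: 2; 6; 13; 17]; [:: 2; 6; 14; 16]; [:: 2; 7; 8; 19]; [:: 2; 7; 9; 11];
[:: 2; 7; 10; 16]; [:: 2; 7; 12; 14]; [:: 2; 7; 13; 15]; [:: 2; 7; 17; 18];
[:: 2; 8; 11; 15]; [:: 2; 8; 14; 18]; [:: 2; 9; 10; 13]; [:: 2; 9; 12; 18];
[:: 2; 10; 15; 17]; [:: 2; 11; 13; 16]; [:: 2; 12; 16; 19]; [:: 2; 14; 17; 19];
[:: 3; 4; 8; 16]; [:: 3; 4; 9; 17]; [:: 3; 4; 10; 15]; [:: 3; 4; 11; 13];
[:: 3; 4; 12; 18]; [:: 3; 4; 14; 19]; [:: 3; 5; 8; 18]; [:: 3; 5; 9; 11];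
[:: 3; 5; 10; 16]; [:: 3; 5; 12; 15]; [:: 3; 5; 13; 14]; [:: 3; 5; 17; 19];
[:: 3; 6; 8; 10]; [:: 3; 6; 9; 18]; [:: 3; 6; 11; 17]; [:: 3; 6; 12; 14];
[:: 3; 6; 13; 15]; [:: 3; 6; 16; 19]; [:: 3; 7; 8; 14]; [:: 3; 7; 9; 13];
[:: 3; 7; 10; 19]; [:: 3; 7; 11; 18]; [:: 3; 7; 12; 16]; [:: 3; 7; 15; 17];
[:: 3; 8; 11; 12]; [:: 3; 8; 13; 19]; [:: 3; 9; 10; 14]; [:: 3; 9; 15; 19];
[:: 3; 10; 12; 17]; [:: 3; 11; 14; 16]; [:: 3; 13; 17; 18]; [:: 3; 15; 16; 18];
[:: 4; 6; 8; 17]; [:: 4; 6; 9; 16]; [:: 4; 6; 10; 12]; [:: 4; 6; 11; 15];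
[:: 4; 6; 13; 19]; [:: 4; 6; 14; 18]; [:: 4; 7; 8; 12]; [:: 4; 7; 9; 15];
[:: 4; 7; 10; 18]; [:: 4; 7; 11; 19]; [:: 4; 7; 13; 16]; [:: 4; 7; 14; 17];
[:: 4; 8; 11; 14]; [:: 4; 8; 15; 18]; [:: 4; 9; 11; 12]; [:: 4; 9; 13; 18];
[:: 4; 10; 13; 17]; [:: 4; 10; 14; 16]; [:: 4; 12; 17; 19]; [:: 4; 15; 16; 19];
[:: 5; 6; 8; 14]; [:: 5; 6; 9; 13]; [:: 5; 6; 10; 18]; [:: 5; 6; 11; 19];
[:: 5; 6; 12; 17]; [:: 5; 6; 15; 16]; [:: 5; 7; 8; 17]; [:: 5; 7; 9; 16];
[:: 5; 7; 10; 14]; [:: 5; 7; 11; 13]; [:: 5; 7; 12; 18]; [:: 5; 7; 15; 19];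
[:: 5; 8; 10; 13]; [:: 5; 8; 12; 19]; [:: 5; 9; 10; 15]; [:: 5; 9; 14; 19];
[:: 5; 11; 12; 16]; [:: 5; 11; 15; 17]; [:: 5; 13; 16; 18]; [:: 5; 14; 17; 18];
[:: 6; 8; 11; 13]; [:: 6; 8; 15; 19]; [:: 6; 9; 11; 14]; [:: 6; 9; 12; 19];
[:: 6; 10; 13; 16]; [:: 6; 10; 14; 17]; [:: 6; 12; 16; 18]; [:: 6; 15; 17; 18];
[:: 7; 8; 10; 15]; [:: 7; 8; 13; 18]; [:: 7; 9; 10; 12]; [:: 7; 9; 14; 18];
[:: 7; 11; 12; 17]; [:: 7; 11; 15; 16]; [:: 7; 13; 17; 19]; [:: 7; 14; 16; 19];
[:: 8; 10; 16; 18]; [:: 8; 10; 17; 19]; [:: 8; 11; 16; 19]; [:: 8; 11; 17; 18];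
[:: 8; 12; 14; 16]; [:: 8; 12; 15; 17]; [:: 8; 13; 14; 17]; [:: 8; 13; 15; 16];
[:: 9; 10; 16; 19]; [:: 9; 10; 17; 18]; [:: 9; 11; 16; 18]; [:: 9; 11; 17; 19];
[:: 9; 12; 14; 17]; [:: 9; 12; 15; 16]; [:: 9; 13; 14; 16]; [:: 9; 13; 15; 17];
[:: 10; 12; 14; 18]; [:: 10; 12; 15; 19]; [:: 10; 13; 14; 19]; [:: 10; 13; 15; 18];
[:: 11; 12; 14; 19]; [:: 11; 12; 15; 18]; [:: 11; 13; 14; 18]; [:: 11; 13; 15; 19]].

Definition colors2 : seq (seq nat) := [::
[:: 8; 4; 7; 5; 2; 6; 3; 9; 6; 5; 2; 7; 9; 8; 4; 3; 0; 3; 1; 9; 4; 7; 3; 8; 7; 0; 1; 6; 5; 0; 1; 7; 8; 2; 9; 1; 6; 2; 0; 4; 8; 1; 2; 6; 0; 4; 3; 5];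
[:: 5; 6; 7; 2; 8; 9; 4; 3; 4; 8; 5; 7; 6; 2; 3; 9; 8; 3; 0; 7; 1; 6; 3; 0; 1; 4; 9; 7; 1; 9; 6; 0; 2; 4; 9; 5; 7; 1; 8; 2; 2; 6; 8; 1; 4; 0; 3; 5];
[:: 5; 4; 2; 8; 7; 6; 3; 9; 6; 7; 9; 2; 3; 4; 8; 5; 0; 7; 1; 8; 9; 3; 5; 6; 9; 0; 3; 1; 7; 0; 8; 2; 5; 1; 1; 9; 6; 2; 4; 0; 3; 6; 1; 5; 2; 7; 0; 4];
[:: 7; 6; 2; 9; 8; 3; 4; 5; 4; 5; 8; 2; 6; 7; 3; 9; 6; 5; 0; 9; 3; 1; 7; 0; 1; 9; 4; 3; 9; 1; 6; 8; 2; 0; 0; 7; 2; 8; 5; 1; 1; 5; 3; 6; 7; 2; 0; 4];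
[:: 5; 6; 1; 3; 9; 8; 4; 7; 4; 8; 9; 5; 7; 3; 1; 6; 8; 6; 2; 9; 3; 0; 3; 9; 0; 7; 5; 2; 5; 7; 2; 8; 0; 1; 7; 1; 6; 4; 2; 0; 6; 2; 0; 8; 1; 4; 3; 5];
[:: 8; 4; 9; 5; 3; 7; 1; 6; 6; 5; 3; 1; 9; 4; 8; 7; 5; 3; 7; 0; 4; 2; 6; 8; 2; 3; 9; 0; 1; 7; 4; 6; 2; 0; 7; 9; 8; 2; 0; 5; 0; 8; 6; 2; 1; 4; 3; 5];
[:: 8; 9; 1; 5; 2; 7; 4; 6; 5; 4; 2; 6; 9; 8; 1; 7; 9; 3; 4; 6; 0; 2; 8; 7; 2; 0; 5; 3; 6; 0; 1; 4; 8; 3; 5; 9; 0; 1; 3; 6; 3; 0; 8; 2; 7; 9; 5; 1];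
[:: 9; 5; 7; 2; 6; 1; 8; 4; 6; 4; 5; 9; 1; 2; 7; 8; 3; 8; 2; 5; 4; 0; 0; 3; 8; 6; 9; 2; 8; 5; 7; 1; 0; 3; 1; 7; 4; 9; 3; 0; 9; 2; 0; 1; 4; 3; 5; 6];
[:: 3; 7; 1; 8; 2; 9; 6; 5; 5; 2; 9; 3; 7; 6; 1; 8; 8; 9; 0; 2; 6; 4; 4; 6; 9; 5; 8; 0; 6; 7; 0; 3; 1; 0; 7; 4; 4; 5; 4; 8; 0; 3; 7; 1; 3; 9; 2; 1];
[:: 2; 5; 3; 9; 6; 7; 1; 8; 7; 3; 8; 1; 9; 2; 6; 5; 6; 4; 5; 9; 8; 0; 9; 8; 2; 0; 6; 4; 0; 1; 7; 4; 7; 6; 0; 3; 4; 8; 4; 5; 1; 7; 3; 0; 1; 2; 9; 3];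
[:: 6; 7; 1; 8; 2; 9; 3; 4; 8; 4; 3; 6; 7; 1; 2; 9; 0; 7; 4; 2; 5; 3; 6; 3; 8; 0; 9; 5; 9; 7; 4; 5; 5; 4; 9; 0; 0; 1; 5; 8; 1; 7; 6; 2; 0; 1; 2; 8];
[:: 4; 8; 6; 3; 1; 7; 2; 9; 7; 6; 8; 1; 9; 2; 3; 4; 3; 6; 0; 8; 9; 5; 7; 0; 2; 4; 5; 3; 4; 5; 0; 9; 7; 9; 4; 5; 8; 5; 0; 1; 2; 6; 7; 1; 8; 2; 1; 0];
[:: 3; 7; 4; 8; 2; 9; 5; 1; 8; 2; 9; 5; 1; 4; 3; 7; 5; 9; 7; 0; 6; 2; 3; 6; 8; 5; 9; 0; 6; 8; 0; 1; 4; 1; 0; 7; 5; 0; 7; 6; 6; 2; 9; 3; 2; 8; 3; 4];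
[:: 2; 8; 5; 9; 4; 1; 3; 7; 7; 3; 8; 4; 9; 2; 5; 1; 6; 3; 5; 8; 9; 0; 9; 5; 0; 7; 6; 2; 1; 4; 0; 7; 8; 6; 0; 1; 7; 6; 5; 0; 3; 9; 2; 6; 4; 3; 8; 2];
[:: 9; 6; 3; 4; 5; 8; 2; 1; 8; 4; 1; 5; 2; 9; 6; 3; 7; 3; 0; 4; 5; 2; 0; 9; 8; 7; 3; 2; 4; 5; 8; 6; 1; 0; 8; 7; 6; 9; 2; 1; 9; 3; 0; 5; 1; 4; 7; 0];
[:: 4; 8; 5; 1; 9; 2; 6; 3; 6; 9; 4; 3; 8; 5; 2; 1; 9; 7; 0; 8; 3; 2; 3; 0; 4; 7; 5; 2; 7; 1; 8; 0; 5; 4; 8; 6; 2; 1; 6; 9; 5; 7; 3; 9; 7; 0; 4; 1];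
[:: 6; 9; 7; 4; 1; 5; 3; 2; 3; 7; 9; 5; 2; 6; 4; 1; 0; 9; 5; 2; 4; 7; 5; 8; 6; 0; 3; 2; 8; 1; 6; 3; 0; 7; 1; 3; 9; 4; 9; 8; 7; 0; 2; 8; 1; 6; 5; 0];
[:: 7; 3; 5; 9; 6; 2; 4; 1; 9; 6; 4; 7; 5; 1; 3; 2; 8; 5; 0; 6; 3; 2; 9; 0; 2; 5; 4; 7; 7; 0; 1; 3; 1; 8; 6; 3; 9; 8; 9; 4; 6; 1; 0; 5; 0; 7; 8; 2];
[:: 2; 6; 4; 7; 8; 5; 1; 3; 3; 4; 1; 8; 7; 6; 5; 2; 6; 4; 0; 9; 5; 7; 3; 9; 2; 8; 7; 0; 9; 7; 8; 5; 6; 0; 1; 3; 4; 1; 2; 1; 3; 6; 0; 9; 8; 9; 2; 4];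
[:: 4; 3; 8; 1; 6; 7; 5; 2; 6; 2; 7; 4; 5; 8; 3; 1; 0; 3; 8; 2; 7; 9; 4; 6; 0; 9; 7; 5; 9; 6; 1; 3; 7; 0; 5; 8; 1; 2; 4; 1; 0; 9; 6; 3; 4; 2; 0; 8]].

(* The three systems serve circles missing inf, circles through inf only, and
   circles through inf and zero; inf gets label 0 and zero gets label 1. *)
Definition mode0 (g : nat) : option nat := None.
Definition mode1 (g : nat) : option nat := if g == 0 then None else Some 0.
Definition mode2 (g : nat) : option nat := Some (nat_of_bool (g == 0)).

Lemma table0_ok : table_ok mode0 blocks0 colors0. Proof. by vm_compute. Qed.
Lemma table1_ok : table_ok mode1 blocks1 colors1. Proof. by vm_compute. Qed.
Lemma table2_ok : table_ok mode2 blocks2 colors2. Proof. by vm_compute. Qed.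

Definition table_mode (t : 'I_3) := nth mode0 [:: mode0; mode1; mode2] t.
Definition table_blocks (t : 'I_3) := nth [::] [:: blocks0; blocks1; blocks2] t.
Definition table_colors (t : 'I_3) := nth [::] [:: colors0; colors1; colors2] t.

Lemma tables_ok t : table_ok (table_mode t) (table_blocks t) (table_colors t).
Proof.
by case: t => -[|[|[|k]]] lt; [exact: table0_ok | exact: table1_ok | exact: table2_ok | ].
Qed.

(** * Placing the three systems on the circles *)

Section Placement.
Variables (P D : finType) (circles : {set {set P}}) (dir : P -> {set P} -> D).
Hypothesis circle_ex : forall T : {set P}, #|T| = 3 ->
  exists2 C, C \in circles & T \subset C.
Hypothesis circle_inj : forall (T C C' : {set P}), #|T| = 3 ->
  C \in circles -> C' \in circles -> T \subset C -> T \subset C' -> C = C'.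
Hypothesis card_circle : forall C, C \in circles -> #|C| = 10.
Hypothesis par_ex : forall x y C, C \in circles -> x \in C -> y != x ->
  exists2 C', C' \in circles & [/\ x \in C', y \in C' & dir x C' = dir x C].
Hypothesis par_inj : forall x y C C', C \in circles -> C' \in circles ->
  x \in C -> x \in C' -> y \in C -> y \in C' -> y != x ->
  dir x C = dir x C' -> C = C'.
Variables (inf zero : P).
Hypothesis inf_zero : inf != zero.

(** The second point is [inf] for every [x] but [inf] itself. The coloring required on a circle then
    depends only on whether it contains [inf] and [zero], so three tables suffice. *)
Let o x := if x == inf then zero else inf.

Let o_neq x : o x != x.
Proof.
by rewrite /o; case: (eqVneq x inf) => [->|xi]; rewrite eq_sym // xi.
Qed.

(** The number of the table for [C]. The point [zero] counts only together with [inf], for on a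
    circle without [inf] no point has its second point on the circle. *)
Definition ctype (C : {set P}) : 'I_3 := inord ((inf \in C) + ((inf \in C) && (zero \in C))).

Definition labels (C : {set P}) : seq P :=
  if inf \in C then inf :: (if zero \in C then zero :: enum (C :\ inf :\ zero) else enum (C :\ inf))
  else enum C.

Lemma mem_labels C x : (x \in labels C) = (x \in C).
Proof.
rewrite /labels; case: ifP => [iC|_]; last by rewrite mem_enum.
rewrite inE; have [->|xi] /= := eqVneq x inf; first by rewrite iC.
case: ifP => [zC|_]; last by rewrite mem_enum !inE xi.
by rewrite inE mem_enum !inE xi; have [->|] := eqVneq x zero.
Qed.

Lemma labels_uniq C : uniq (labels C).
Proof.
rewrite /labels; case: ifP => [iC|_]; last exact: enum_uniq.
case: ifP => [zC|_] /=; last by rewrite mem_enum !inE eqxx enum_uniq.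
by rewrite inE !mem_enum !inE !eqxx /= (negPf inf_zero) enum_uniq andbF.
Qed.

Lemma size_labels C : C \in circles -> size (labels C) = 10.
Proof.
move=> CC; rewrite -(card_circle CC) -(card_uniqP (labels_uniq C)).
by apply: eq_card => x; rewrite mem_labels.
Qed.

Definition emb C (i : 'I_10) : P := nth inf (labels C) i.

Lemma emb_in C i : C \in circles -> emb C i \in C.
Proof. by move=> CC; rewrite -mem_labels mem_nth // size_labels. Qed.

Lemma emb_inj C : C \in circles -> injective (emb C).
Proof.
move=> CC i j /eqP; rewrite nth_uniq ?labels_uniq ?size_labels // => /eqP.
exact: val_inj.
Qed.

Lemma emb_surj C x : C \in circles -> x \in C -> exists i, emb C i = x.
Proof.
move=> CC; rewrite -mem_labels => xC.
have lt : index x (labels C) < 10 by rewrite -(size_labels CC) index_mem.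
by exists (Ordinal lt); rewrite /emb nth_index.
Qed.

(** Since [labels] lists [inf] first and [zero] second, the label in the mode of the table is the
    one of the second point. *)
Lemma mode_special C i : C \in circles -> o (emb C i) \in C ->
  exists j : 'I_10, table_mode (ctype C) i = Some (j : nat) /\ emb C j = o (emb C i).
Proof.
move=> CC; have E0 : emb C ord0 = head inf (labels C) by rewrite /emb nth0.
have i0 : (i == 0 :> nat) = (emb C i == emb C ord0) by rewrite (inj_eq (emb_inj CC)).
rewrite /table_mode /ctype inordK; last by case: (_ \in _) (_ \in _) => [] [].
have [iC|iC] /= := boolP (inf \in C); last first.
  move=> oC; exfalso; move: oC; rewrite /o.
  case: eqP => [E|_]; last by rewrite (negPf iC).
  by have := emb_in i CC; rewrite E (negPf iC).
have Ei : emb C ord0 = inf by rewrite E0 /labels iC.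
have [zC|zC] /= := boolP (zero \in C); rewrite /o -Ei.
  rewrite /mode2 i0; case: eqP => [E _|_ _]; last by exists ord0.
  by exists (inord 1); rewrite inordK //; split=> //; rewrite /emb inordK // /labels iC zC.
rewrite /mode1 i0; case: eqP => [E|_ _]; last by exists ord0.
by rewrite (negPf zC).
Qed.

Lemma mode_none C i : C \in circles -> o (emb C i) \notin C ->
  table_mode (ctype C) i = None.
Proof.
move=> CC; have E0 : emb C ord0 = head inf (labels C) by rewrite /emb nth0.
have i0 : (i == 0 :> nat) = (emb C i == emb C ord0) by rewrite (inj_eq (emb_inj CC)).
rewrite /table_mode /ctype inordK; last by case: (_ \in _) (_ \in _) => [] [].
have [iC|iC] //= := boolP (inf \in C).
have Ei : emb C ord0 = inf by rewrite E0 /labels iC.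
have [zC|zC] /= := boolP (zero \in C); rewrite /o -Ei; case: eqP => E.
- by rewrite zC.
- by rewrite Ei iC.
- by rewrite /mode1 i0 E eqxx.
- by rewrite Ei iC.
Qed.

Notation Q := (P * bool)%type.

Definition place C (p : Q0) : Q := (emb C p.1, p.2).

Lemma place_inj C : C \in circles -> injective (place C).
Proof. by move=> CC [i b] [j c] [/(emb_inj CC) -> ->]. Qed.

Definition local C : {set {set Q}} :=
  [set place C @: B | B : {set Q0} in blocks (table_blocks (ctype C))].

(** Only its values at points over [C] matter, so the default is arbitrary. *)
Definition unplace C (p : Q) : Q0 := odflt (ord0, true) [pick p0 | place C p0 == p].

Lemma placeK C : C \in circles -> cancel (place C) (unplace C).
Proof.
move=> CC p; rewrite /unplace; case: pickP => [q /eqP/(place_inj CC)//|/(_ p)].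
by rewrite eqxx.
Qed.

Definition lcolor C (p : Q) (B : {set Q}) : nat :=
  block_color (table_blocks (ctype C)) (table_colors (ctype C))
              (unplace C p) (place C @^-1: B).

Lemma preimset_place C (B : {set Q0}) : C \in circles -> place C @^-1: (place C @: B) = B.
Proof.
by move=> CC; apply/setP => p; rewrite inE (mem_imset _ _ (place_inj CC)).
Qed.

Variant local_spec C (p : Q) (B : {set Q}) : Prop :=
  LocalSpec B0 p0 of B0 \in blocks (table_blocks (ctype C)) & p0 \in B0 &
    B = place C @: B0 & p = place C p0 &
    lcolor C p B = block_color (table_blocks (ctype C)) (table_colors (ctype C)) p0 B0.

Lemma localP C p B : C \in circles -> B \in local C -> p \in B -> local_spec C p B.
Proof.
move=> CC /imsetP[B0 B0H ->] /imsetP[p0 p0B ->].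
by exists B0 p0; rewrite // /lcolor placeK // preimset_place.
Qed.

(** The same table entry is read as the label of a point of [C] or as the index of a parallel class.
    The checked bounds 10 and 8 make [inord] faithful in the two modes. *)
Let kap C p B : P := emb C (inord (lcolor C p B)).
Let rho C p B : 'I_8 := inord (lcolor C p B).

(** Each hypothesis on the local systems is a checked property of a table, carried over along
    [place]. *)
Lemma glued_system : exists Bs : {set {set Q}},
  is_SQS Bs /\ forall p, r_colorable (derived Bs p) #|P|.
Proof.
have ok C := tables_ok (ctype C).
have Hcard C B : C \in circles -> B \in local C -> #|B| = 4.
  move=> CC /imsetP[B0 B0H ->]; rewrite card_imset; last exact: place_inj.
  exact: card_block (ok C) _ B0H.
have Hinj C B : C \in circles -> B \in local C -> {in B &, injective fst}.
  move=> CC /imsetP[B0 B0H ->] _ _ /imsetP[p pB ->] /imsetP[q qB ->] /= /(emb_inj CC) E.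
  by rewrite (block_fst_inj (ok C) B0H pB qB E).
have Hsub C B : C \in circles -> B \in local C -> {in B, forall p, p.1 \in C}.
  by move=> CC /imsetP[B0 _ ->] _ /imsetP[p _ ->]; apply: emb_in.
have Htriple C (T : {set Q}) : C \in circles -> #|T| = 3 ->
    {in T &, injective fst} -> {in T, forall p, p.1 \in C} ->
    #|[set B in local C | T \subset B]| = 1.
  move=> CC T3 Ti TC.
  have [T0 _ ET] : exists2 T0 : {set Q0}, T0 \subset setT & T = place C @: T0.
    apply: preim_in; apply/subsetP => -[x b] xT.
    have [i Ei] := emb_surj CC (TC _ xT); apply/imsetP; exists (i, b) => //.
    by rewrite /place Ei.
  rewrite ET (@card_imset_blocks _ _ _ setT) //; last by move=> p q _ _ /(place_inj CC).
  apply: (block_triple (ok C)).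
    by apply: etrans T3; rewrite ET card_imset //; apply: place_inj.
  move=> p q pT qT E; apply: (place_inj CC); apply: Ti; rewrite ?ET ?imset_f //=.
  by rewrite E.
have color10 C p B : C \in circles -> o p.1 \in C -> B \in local C -> p \in B ->
    [/\ lcolor C p B < 10, forall q, q \in B -> q != p -> kap C p B != q.1 &
        forall q, q \in B -> q != p -> kap C p B = p.1 -> q.1 != o p.1].
  move=> CC oC BH pB; case: (localP CC BH pB) oC => B0 p0 B0H p0B -> -> Ec oC.
  have [j [Mj Ej]] := mode_special CC oC.
  have [c10 out avoid] := block_color_special (ok C) B0H p0B Mj.
  have K : (inord (lcolor C (place C p0) (place C @: B0)) : 'I_10) =
      block_color (table_blocks (ctype C)) (table_colors (ctype C)) p0 B0 :> nat.
    by rewrite Ec inordK.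
  split=> [|_ /imsetP[q qB ->]|_ /imsetP[q qB ->]]; first by rewrite Ec.
    rewrite (inj_eq (place_inj CC)) => qp; rewrite /kap (inj_eq (emb_inj CC)) -val_eqE /= K eq_sym.
    exact: out.
  rewrite (inj_eq (place_inj CC)) => qp /(emb_inj CC)/(congr1 val); rewrite /= K => E.
  by rewrite -Ej (inj_eq (emb_inj CC)); apply: avoid.
have proper C p B B' : C \in circles -> B \in local C -> B' \in local C ->
    p \in B -> p \in B' -> B != B' -> lcolor C p B = lcolor C p B' -> meet_only p B B'.
  move=> CC BH BH' pB pB'; case: (localP CC BH pB) => B0 p0 B0H p0B -> Ep ->.
  case: (localP CC BH' pB') => B0' p0' B0H' p0B' -> Ep' ->.
  have E : p0 = p0' by apply: (place_inj CC); rewrite -Ep.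
  subst p0'; rewrite Ep => nB Ec _ /imsetP[q qB ->]; rewrite (mem_imset _ _ (place_inj CC)) => qB'.
  congr place; apply: (block_color_proper (ok C) B0H B0H') Ec q qB qB' => //.
  by apply: contraNneq nB => ->.
exists (glued circles local); split.
  exact: (glued_SQS circle_ex circle_inj Hcard Hinj Hsub Htriple).
apply: (@glued_colorable _ _ _ dir _ _ _ _ o local kap rho) => //.
- by move=> C p B CC _ _ _; apply: emb_in.
- by move=> C p B q CC oC BH pB qB qp; have [_ + _] := color10 C p B CC oC BH pB; apply.
(* The table check speaks of the points other than [p]; the point [p] itself is off the fiber of
   [o p.1] by [o_neq]. *)
- move=> C p B q CC oC BH pB qB; have [->|qp] := eqVneq q p; first by rewrite eq_sym o_neq.
  by have [_ _] := color10 C p B CC oC BH pB; apply.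
- move=> C p B B' CC oC BH BH' pB pB' nB /(emb_inj CC)/(congr1 val).
  have [c _ _] := color10 C p B CC oC BH pB; have [c' _ _] := color10 C p B' CC oC BH' pB'.
  by rewrite /= !inordK //; apply: proper.
- move=> C p B B' CC oC BH BH' pB pB' nB E; apply: (proper C) => //.
  have lt8 A : A \in local C -> p \in A -> lcolor C p A < 8.
    move=> AH pA; case: (localP CC AH pA) => A0 p0 A0H p0A _ Ep ->.
    apply: (block_color_lt8 (ok C)) => //; apply: mode_none => //.
    by move: oC; rewrite Ep.
  by move/(congr1 val): E; rewrite /= !inordK ?lt8.
Qed.

End Placement.

(** * Circles of the projective line *)

Section Circles.
Local Open Scope ring_scope.
Variables (F : finFieldType) (K : {pred F}).
Hypothesis K1 : 1 \in K.
Hypothesis KB : forall s t, s \in K -> t \in K -> s - t \in K.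
Hypothesis KM : forall s t, s \in K -> t \in K -> s * t \in K.
Hypothesis KV : forall s, s \in K -> s^-1 \in K.

Lemma K0 : 0 \in K. Proof. by rewrite -(subrr 1) KB. Qed.
(** The projective line over [F], with [None] as the point at infinity. *)
Notation P := (option F).
Implicit Types (x y a b c d e u v : P) (C : {set P}).

(* The affine coordinate on the line minus x, with x sent to infinity; the value at x itself is junk. *)
Definition phi x c : F :=
  match x, c with
  | None, Some v => v
  | Some u, Some v => (v - u)^-1
  | _, None => 0
  end.

Definition phi_inv x (t : F) : P :=
  match x with
  | None => Some t
  | Some u => if t == 0 then None else Some (u + t^-1)
  end.

Lemma phi_inj x a b : a != x -> b != x -> phi x a = phi x b -> a = b.
Proof.
have S (u v : F) : (Some u == Some v) = (u == v) by [].
case: x a b => [u|] [a|] [b|] //=; rewrite ?S.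
- by move=> _ _ /invr_inj /addIr ->.
- by move=> au _ /eqP; rewrite invr_eq0 subr_eq0 (negPf au).
- by move=> _ bu /esym/eqP; rewrite invr_eq0 subr_eq0 (negPf bu).
- by move=> _ _ ->.
Qed.

Lemma phi_invK x t : phi x (phi_inv x t) = t.
Proof.
case: x => [u|] //=; case: eqP => [->|] //= _.
by rewrite addrAC subrr add0r invrK.
Qed.

Lemma phi_inv_neq x t : phi_inv x t != x.
Proof.
case: x => [u|] //=; case: (t =P 0) => [_|/eqP t0] //=.
by apply/eqP => -[/eqP]; rewrite -subr_eq0 addrAC subrr add0r invr_eq0 (negPf t0).
Qed.

Lemma phiK x c : c != x -> phi_inv x (phi x c) = c.
Proof. by move=> cx; apply: (@phi_inj x); rewrite ?phi_inv_neq ?phi_invK. Qed.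

(** The cross ratio: the coordinate of [c] when [x], [a], [b] are moved to infinity, 0 and 1. *)
Definition slope x a b c : F := (phi x c - phi x a) / (phi x b - phi x a).

Lemma phiB_neq0 x a b : a != x -> b != x -> a != b -> phi x b - phi x a != 0.
Proof.
by move=> ax bx ab; rewrite subr_eq0; apply: contraNneq ab => /phi_inj ->.
Qed.

(* With slopeC, this makes the condition slope x a b c \in K independent of the
   order of the four points. *)
Lemma slopeV x a b c : uniq [:: x; a; b; c] ->
  slope x a b c * slope a x b c = 1.
Proof.
have S (u v : F) : (Some u == Some v) = (v - u == 0).
  by rewrite subr_eq0 [RHS]eq_sym.
rewrite /= !inE !negb_or => /and4P[/and3P[xa xb xc] /andP[ab ac] bc _].
have nz1 : phi x b - phi x a != 0 by apply: phiB_neq0 => //; rewrite eq_sym.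
have nz2 : phi a b - phi a x != 0 by apply: phiB_neq0 => //; rewrite eq_sym.
move: xa xb xc ab ac bc nz1 nz2; rewrite /slope.
(* For finite points put [p = a - x] and [r = c - a]: the left side is the product of the two
   numerators. Its value is free of [c], so the denominators, with [b] for [c], have the same
   product. *)
have N p r : p != 0 -> r != 0 -> p + r != 0 ->
    ((p + r)^-1 - p^-1) * (r^-1 + p^-1) = - p^-1 ^+ 2 :> F.
  by move=> p0 r0 pr; field; rewrite p0 r0.
have B (u v w : F) : w - u = (v - u) + (w - v) by ring.
case: x a b c => [x|] [a|] [b|] [c|] //=; rewrite ?S => xa xb xc ab ac bc.
- rewrite -(opprB a x) !invrN !opprK => n1 n2; rewrite mulrACA -invfM.
  by rewrite (B x a c) (B x a b) !N ?divff ?oppr_eq0 ?expf_neq0 ?invr_neq0 // -B.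
- rewrite -(opprB a x) !invrN !sub0r !opprK => n1 n2; rewrite mulrACA -invfM.
  rewrite (B x a b) !N -?B // mulNr -expr2 divff // oppr_eq0 expf_neq0 //.
  exact: invr_neq0.
- rewrite -(opprB a x) !invrN !sub0r !opprK => n1 n2; rewrite mulrACA -invfM.
  rewrite (B x a c) !N -?B // [X in _ / X]mulNr -expr2 divff //.
  by rewrite oppr_eq0 expf_neq0 // invr_neq0.
- by rewrite !subr0 => n1 n2; field; rewrite xb xc oner_neq0.
- by rewrite !subr0 => n1 n2; field; rewrite ab ac oner_neq0.
Qed.

Lemma slopeC x a b c : a != x -> b != x -> a != b ->
  slope x b a c = 1 - slope x a b c.
Proof.
move=> ax bx ab; have := phiB_neq0 ax bx ab; rewrite /slope.
move: (phi x a) (phi x b) (phi x c) => s t r st.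
rewrite -[s - t]opprB invrN mulrN -mulNr -[1](divff st) -mulrBl.
by congr (_ / _); ring.
Qed.

(** The image of the projective line over [K] that passes through [x], [a], [b]. The point [x] is
    added by hand because its own coordinate is a junk value. *)
Definition circ x a b : {set P} :=
  x |: [set c | (c != x) && (slope x a b c \in K)].

Lemma mem_circ x a b c : c != x -> (c \in circ x a b) = (slope x a b c \in K).
Proof. by move=> cx; rewrite !inE (negPf cx). Qed.

Lemma circ1 x a b : x \in circ x a b. Proof. by rewrite !inE eqxx. Qed.

Lemma circ2 x a b : a \in circ x a b.
Proof. by rewrite !inE /slope subrr mul0r K0 andbT orbN. Qed.

Lemma circ3 x a b : uniq [:: x; a; b] -> b \in circ x a b.
Proof.
rewrite /= !inE !negb_or => /and3P[/andP[xa xb] ab _].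
by rewrite /slope divff ?K1 ?andbT ?orbN // phiB_neq0 // eq_sym.
Qed.

(** The exchange replaces a cross ratio s by 1 - s, which preserves [K]. *)
Lemma circ_swap23 x a b : uniq [:: x; a; b] -> circ x b a = circ x a b.
Proof.
rewrite /= !inE !negb_or => /and3P[/andP[xa xb] ab _].
apply/setP => c; rewrite !inE; congr (_ || (_ && _)).
have E : slope x b a c = 1 - slope x a b c by rewrite slopeC // eq_sym.
by apply/idP/idP => [h|h]; [rewrite -[slope x a b c](subKr 1) -E KB | rewrite E KB].
Qed.

(** The exchange inverts the cross ratio by [slopeV], and [K] is closed under inverses. The points
    [x], [a], [b], to which [slopeV] does not apply, are treated apart. *)
Lemma circ_swap12 x a b : uniq [:: x; a; b] -> circ a x b = circ x a b.
Proof.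
move=> U; have [xa [xb ab]] : x != a /\ x != b /\ a != b.
  by move: U; rewrite /= !inE !negb_or => /and3P[/andP[]].
have Ua : uniq [:: a; x; b] by rewrite /= !inE negb_or eq_sym xa ab xb.
apply/setP => c.
have [->|cx] := eqVneq c x; first by rewrite circ1 circ2.
have [->|ca] := eqVneq c a; first by rewrite circ1 circ2.
have [->|cb] := eqVneq c b; first by rewrite !circ3.
rewrite !mem_circ //.
have /slopeV E : uniq [:: x; a; b; c].
  by rewrite /= !inE !negb_or xa xb ab /= 3?[_ == c]eq_sym cx ca cb.
have -> : slope a x b c = (slope x a b c)^-1.
  apply: (mulfI (x := slope x a b c)); last first.
    rewrite E divff //; apply: contraTneq (oner_neq0 F) => Z.
    by rewrite -E Z mul0r eqxx.
  by apply: contraTneq (oner_neq0 F) => Z; rewrite -E Z mul0r eqxx.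
by apply/idP/idP => /KV; rewrite ?invrK.
Qed.

(** Taking [c] instead of [b] as unit point divides every cross ratio by the nonzero element
    [slope x a b c] of [K]. *)
Lemma circ_exchange x a b c :
  uniq [:: x; a; b] -> c \in circ x a b -> c != x -> c != a ->
  circ x a c = circ x a b.
Proof.
rewrite /= !inE !negb_or => /and3P[/andP[xa xb] ab _] + cx ca.
rewrite cx (negPf cx) /= => sK.
have ax : a != x by rewrite eq_sym.
have bx : b != x by rewrite eq_sym.
have nb := phiB_neq0 ax bx ab.
have nc : phi x c - phi x a != 0 by apply: phiB_neq0; rewrite // eq_sym.
apply/setP => d; rewrite !inE; congr (_ || (_ && _)).
have E : slope x a b d = slope x a c d * slope x a b c.
  by rewrite /slope mulrA divfK.
have E' : slope x a c d = slope x a b d * (slope x a b c)^-1.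
  by rewrite E mulfK // /slope mulf_neq0 // invr_neq0.
by apply/idP/idP => h; [rewrite E KM | rewrite E' KM // KV].
Qed.

Definition circles : {set {set P}} :=
  [set C | [exists x, exists a, exists b, uniq [:: x; a; b] && (C == circ x a b)]].

Lemma circlesP C :
  reflect (exists x a b, uniq [:: x; a; b] /\ C = circ x a b) (C \in circles).
Proof.
rewrite inE; apply: (iffP existsP) => [[x /existsP[a /existsP[b /andP[U /eqP ->]]]]|].
  by exists x, a, b.
case=> x [a [b [U ->]]]; exists x; apply/existsP; exists a; apply/existsP.
by exists b; rewrite U eqxx.
Qed.

Lemma circ_in x a b : uniq [:: x; a; b] -> circ x a b \in circles.
Proof. by move=> U; apply/circlesP; exists x, a, b. Qed.

(** Any point of a circle can serve as its base point: [d] first replaces [b] and then moves to the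
    front by the two swaps. *)
Lemma circle_at C d : C \in circles -> d \in C ->
  exists a b, uniq [:: d; a; b] /\ C = circ d a b.
Proof.
case/circlesP => x [a [b [U ->]]] dC.
have rot u v w : uniq [:: u; v; w] -> uniq [:: v; u; w].
  by rewrite /= !inE !negb_or [v == u]eq_sym => /and3P[/andP[-> ->] ->].
have rot' u v w : uniq [:: u; v; w] -> uniq [:: u; w; v].
  by rewrite /= !inE !negb_or [w == v]eq_sym => /and3P[/andP[-> ->] ->].
have [dx|dx] := eqVneq d x; first by rewrite dx; exists a, b.
have [da|da] := eqVneq d a.
  by rewrite da; exists x, b; rewrite circ_swap12 // rot.
have U2 : uniq [:: x; a; d].
  by rewrite /= !inE !negb_or [x == d]eq_sym [a == d]eq_sym dx da; move: U => /= /and3P[]; rewrite !inE negb_or => /andP[->].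
exists x, a; split; first by rewrite rot // rot'.
by rewrite (circ_swap12 (rot' _ _ _ U2)) (circ_swap23 U2) (circ_exchange U dC dx da).
Qed.

Lemma circle_at2 C d e : C \in circles -> d \in C -> e \in C -> e != d ->
  exists b, uniq [:: d; e; b] /\ C = circ d e b.
Proof.
move=> CC dC eC ed; have [a [b [U E]]] := circle_at CC dC.
have Ua : uniq [:: d; b; a].
  by move: U; rewrite /= !inE !negb_or [b == a]eq_sym => /and3P[/andP[-> ->] ->].
have [ea|ea] := eqVneq e a; first by rewrite ea; exists b.
exists a; split.
  rewrite /= !inE !negb_or ea [d == e]eq_sym ed andbT.
  by move: U => /=; rewrite !inE negb_or => /andP[/andP[->]].
have U2 : uniq [:: d; a; e].
  rewrite /= !inE !negb_or [a == e]eq_sym ea [d == e]eq_sym ed !andbT.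
  by move: U => /=; rewrite !inE negb_or => /andP[/andP[->]].
by rewrite (circ_swap23 U2) (circ_exchange U) -?E.
Qed.

(** The points [d], [e], [f] replace the defining points of [C] one after the other. *)
Lemma circle_unique C d e f : C \in circles -> uniq [:: d; e; f] ->
  d \in C -> e \in C -> f \in C -> C = circ d e f.
Proof.
move=> CC; rewrite /= !inE !negb_or => /and3P[/andP[de df] ef _] dC eC fC.
have [|b [U E]] := circle_at2 CC dC eC; first by rewrite eq_sym.
by rewrite (circ_exchange U) -?E // eq_sym.
Qed.

(** In the coordinate at [x], a circle through [x] is a line of [F] viewed as an affine space over
    [K]. *)
Lemma phi_circ x a b c : uniq [:: x; a; b] -> c != x ->
  reflect (exists2 k, k \in K & phi x c = phi x a + k * (phi x b - phi x a))
          (c \in circ x a b).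
Proof.
rewrite /= !inE !negb_or => /and3P[/andP[xa xb] ab _] cx.
have nb : phi x b - phi x a != 0 by apply: phiB_neq0; rewrite // eq_sym.
rewrite cx (negPf cx) /=; apply: (iffP idP) => [sK|[k kK E]].
  by exists (slope x a b c); rewrite // /slope divfK // addrC subrK.
by rewrite /slope E addrAC subrr add0r mulfK.
Qed.

Lemma card_circle C : C \in circles -> #|C| = #|K|.+1.
Proof.
case/circlesP => x [a [b [U ->]]].
have nb : phi x b - phi x a != 0.
  move: U; rewrite /= !inE !negb_or => /and3P[/andP[xa xb] ab _].
  by apply: phiB_neq0; rewrite // eq_sym.
rewrite /circ cardsU1 !inE eqxx /= add1n; congr _.+1.
rewrite -(card_imset K (f := fun k => phi_inv x (phi x a + k * (phi x b - phi x a)))).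
  apply: eq_card => c; rewrite !inE; apply/andP/imsetP => [[cx]|[k kK ->]].
    rewrite -mem_circ // => /(phi_circ U cx)[k kK E].
    by exists k; rewrite // -E phiK.
  split; first exact: phi_inv_neq.
  rewrite -mem_circ ?phi_inv_neq //; apply/(phi_circ U); rewrite ?phi_inv_neq //.
  by exists k; rewrite // phi_invK.
move=> k l /(congr1 (phi x)); rewrite !phi_invK => /addrI; exact: mulIf.
Qed.

(** For a circle through [x], the differences along the corresponding line form its direction, a
    one-dimensional [K]-subspace of [F]. *)
Definition dir x C : {set F} :=
  [set phi x u - phi x v | u in C :\ x, v in C :\ x].

Lemma dir_circ x a b z : uniq [:: x; a; b] ->
  reflect (exists2 k, k \in K & z = k * (phi x b - phi x a)) (z \in dir x (circ x a b)).
Proof.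
move=> U; have ax : a != x.
  by move: U; rewrite /= !inE negb_or eq_sym => /andP[/andP[]].
apply: (iffP imset2P) => [[u v] |[k kK ->]].
  rewrite !in_setD1 => /andP[ux uC] /andP[vx vC] ->.
  have [k kK ->] := phi_circ U ux uC; have [l lK ->] := phi_circ U vx vC.
  by exists (k - l); [exact: KB | ring].
exists (phi_inv x (phi x a + k * (phi x b - phi x a))) a.
- rewrite in_setD1 phi_inv_neq; apply/(phi_circ U); first exact: phi_inv_neq.
  by exists k; rewrite // phi_invK.
- by rewrite in_setD1 ax circ2.
- by rewrite phi_invK; ring.
Qed.

Lemma parallel_exists x y C : C \in circles -> x \in C -> y != x ->
  exists2 C', C' \in circles & [/\ x \in C', y \in C' & dir x C' = dir x C].
Proof.
move=> CC xC yx; have [a [b [U E]]] := circle_at CC xC.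
have nb : phi x b - phi x a != 0.
  move: U; rewrite /= !inE !negb_or => /and3P[/andP[xa xb] ab _].
  by apply: phiB_neq0; rewrite // eq_sym.
(* In the coordinate at [x], this is [y] translated by the vector from [a] to [b]. *)
pose b' := phi_inv x (phi x y + (phi x b - phi x a)).
have Eb : phi x b' - phi x y = phi x b - phi x a by rewrite phi_invK addrC addKr.
have yb' : y != b' by apply: contraNneq nb => yb; rewrite -Eb -yb subrr.
have U' : uniq [:: x; y; b'].
  by rewrite /= !inE negb_or [x == y]eq_sym yx [x == b']eq_sym phi_inv_neq yb'.
exists (circ x y b'); first exact: circ_in.
split; rewrite ?circ1 ?circ2 // E; apply/setP => z.
by apply/(dir_circ _ U')/(dir_circ _ U); rewrite Eb.
Qed.

(** The vector from [y] to [b'] lies in the common direction, so [b'] is on [C] and may replace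
    [b]. *)
Lemma parallel_unique x y C C' : C \in circles -> C' \in circles ->
  x \in C -> x \in C' -> y \in C -> y \in C' -> y != x ->
  dir x C = dir x C' -> C = C'.
Proof.
move=> CC CC' xC xC' yC yC' yx.
have [b [U E]] := circle_at2 CC xC yC yx.
have [b' [U' E']] := circle_at2 CC' xC' yC' yx.
rewrite E E' => D; have b'x : b' != x.
  by move: U'; rewrite /= !inE negb_or [x == b']eq_sym => /andP[/andP[]].
have b'y : b' != y.
  by move: U'; rewrite /= !inE [y == b']eq_sym => /and3P[].
apply/esym/(circ_exchange U) => //; apply/(phi_circ U b'x).
have : phi x b' - phi x y \in dir x (circ x y b').
  by apply/(dir_circ _ U'); exists 1; rewrite ?mul1r.
rewrite -D => /(dir_circ _ U)[k kK h]; exists k => //.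
by rewrite -h addrC subrK.
Qed.

End Circles.

(** * The field of order 9^n and its subfield of order 9 *)

Section Subfield.
Local Open Scope ring_scope.

(** In characteristic 3 the ninth power is additive, being the Frobenius map applied twice. The
    induction step therefore splits off the ninth power of the previous polynomial. *)
Lemma dvdp_X9 (F : fieldType) n : 3%N \in [pchar F] ->
  ('X^9 - 'X : {poly F}) %| 'X^(9 ^ n) - 'X.
Proof.
move=> ch; have chP : 3%N \in [pchar {poly F}] by rewrite pchar_poly.
elim: n => [|n IH]; first by rewrite expn0 expr1 subrr dvdp0.
have -> : 'X^(9 ^ n.+1) - 'X = ('X^(9 ^ n) - 'X) ^+ 9 + ('X^9 - 'X) :> {poly F}.
  have E (u : {poly F}) : u ^+ 9 = pFrobenius_aut chP (pFrobenius_aut chP u).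
    by rewrite !pFrobenius_autE -exprM.
  by rewrite E !rmorphB /= -!E -exprM -expnSr addrA subrK.
by rewrite dvdp_addl ?dvdpp // exprS dvdp_mulr.
Qed.

(** Over [F] the polynomial X^|F| - X is a product of distinct linear factors. Its divisor X^9 - X
    is, up to a unit, a product of some of them, so it has nine distinct roots. *)
Lemma card_fixed9 (F : finFieldType) n : 3%N \in [pchar F] -> #|F| = (9 ^ n)%N ->
  #|[pred z : F | z ^+ 9 == z]| = 9%N.
Proof.
move=> ch cF; have := dvdp_X9 n ch.
rewrite -cF finField_genPoly => /dvdp_prod_XsubC[m Em].
set s := mask m _ in Em; have us : uniq s by rewrite mask_uniq ?index_enum_uniq.
have szp : size ('X^9 - 'X : {poly F}) = 10%N.
  by rewrite size_polyDl size_polyXn // size_polyN size_polyX.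
have := eqp_size Em; rewrite szp size_prod_XsubC => -[szs].
rewrite [RHS]szs -(card_uniqP us); apply: eq_card => z; rewrite !inE.
have := eqp_root Em z; rewrite root_prod_XsubC => <-.
by rewrite /root !hornerE subr_eq0.
Qed.

Lemma field_with_subfield n : (0 < n)%N ->
  exists (F : finFieldType) (K : {pred F}),
    [/\ #|F| = (9 ^ n)%N, #|K| = 9%N, 1 \in K,
        forall s t, s \in K -> t \in K -> s - t \in K &
        (forall s t, s \in K -> t \in K -> s * t \in K) /\
        (forall s, s \in K -> s^-1 \in K)].
Proof.
move=> n0; have n20 : (0 < 2 * n)%N by rewrite muln_gt0.
(* The order is written as a power of the prime 3: 9^n = 3^(2n). *)
have [F ch cF] := PrimePowerField (isT : prime 3) n20.
have cF9 : #|F| = (9 ^ n)%N by rewrite cF expnM.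
exists F, (fun z : F => z ^+ 9 == z); split=> //.
- exact: card_fixed9 cF9.
- by rewrite unfold_in expr1n.
- move=> s t; rewrite !unfold_in => /eqP Es /eqP Et.
  have E (u : F) : u ^+ 9 = pFrobenius_aut ch (pFrobenius_aut ch u).
    by rewrite !pFrobenius_autE -exprM.
  by rewrite E !rmorphB /= -!E Es Et.
- split=> [s t|s]; rewrite !unfold_in; first by move=> /eqP Es /eqP Et; rewrite exprMn Es Et.
  by move=> /eqP Es; rewrite exprVn Es.
Qed.

End Subfield.

(** * Assembly over the projective line *)

Theorem theorem3p9 (n : nat) (hn : 0 < n) :
  exists Bs : {set {set 'I_(2 * 9 ^ n + 2)}}, is_mcDSQS Bs.
Proof.
have [F [K [cF cK K1 KB [KM KV]]]] := field_with_subfield hn.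
have uniq3 (T : {set option F}) : #|T| = 3 -> exists x a b, uniq [:: x; a; b] /\ T = [set x; a; b].
  move=> /set3P[x [a [b [-> xa xb ab]]]]; exists x, a, b.
  by rewrite /= !inE negb_or xa xb ab.
have [Bs [sqs col]] : exists Bs : {set {set (option F * bool)}},
    is_SQS Bs /\ forall p, r_colorable (derived Bs p) #|{: option F}|.
  (* The points [inf] and [zero] are taken to be infinity and 0 of the projective line. *)
  apply: (@glued_system _ _ (circles K) (@dir F) _ _ _ _ _ None (Some 0%R)) => //.
  - move=> T /uniq3[x [a [b [U ->]]]]; exists (circ K x a b); first exact: circ_in.
    apply/subsetP => y /setUP[/setUP[]|] /set1P ->.
    - exact: circ1.
    - exact: circ2.
    - exact: circ3.
  - move=> T C C' /uniq3[x [a [b [U ->]]]] CC CC' TC TC'.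
    have sub (A : {set option F}) : [set x; a; b] \subset A -> [/\ x \in A, a \in A & b \in A].
      by move=> sA; split; apply: (subsetP sA); rewrite !inE eqxx ?orbT.
    have [xC aC bC] := sub C TC; have [xC' aC' bC'] := sub C' TC'.
    by rewrite (circle_unique K1 KB KM KV CC U) // -(circle_unique K1 KB KM KV CC' U).
  - by move=> C /card_circle ->; rewrite cK.
  - exact: parallel_exists.
  - exact: parallel_unique.
have cP : #|{: option F}| = (9 ^ n).+1 by rewrite card_option cF.
(* There are two points over each of the q+1 points of the line, 2q+2 in all, and 3 divides [q]
   because [n] is positive. *)
apply: (mcDSQS_transport (q := 9 ^ n) _ _ _ sqs).
- by rewrite -(prednK hn) expnS dvdn_mulr.
- by rewrite card_prod cP card_bool muln2.
- by rewrite card_ord card_prod cP card_bool [RHS]mulSn [RHS]addnC mulnC.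
- by move=> p; rewrite -cP.
Qed.
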